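(* Let $X_1,\dots,X_g$ be complex $k\times k$ matrices and let $u_1,\dots,u_g$ be the free Haar unitaries in $C^*_r(\mathbb F_g)$. Then the spectral radius of the operator $\sum_{j=1}^gX_j\otimes u_j$ in $M_k(\mathbb C)\otimes C^*_r(\mathbb F_g)$ is equal to $$\rho\Big(\sum_{j=1}^gX_j\otimes\overline{X_j}\Big)^{1/2}.$$
   Context: $\mathbb F_g$ is the free group on generators $\gamma_1,\dots,\gamma_g$, $\lambda$ is its left regular representation on $\ell^2(\mathbb F_g)$, $C^*_r(\mathbb F_g)$ is the reduced group $C^*$-algebra generated by $\lambda(\mathbb F_g)$, and $u_j=\lambda(\gamma_j)$. $\overline{X}$ is the entrywise complex conjugate of the matrix $X$, and $\rho$ denotes the spectral radius. *)

(* Defs.v *)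
From HB Require Import structures.
From mathcomp Require Import all_boot all_order all_algebra.
From mathcomp Require Import all_classical all_reals ereal esum.
From mathcomp Require Import complex mxtens.
From mathcomp Require Import ring lra.

Set Implicit Arguments.
Unset Strict Implicit.
Unset Printing Implicit Defensive.

Import Order.TTheory GRing.Theory Num.Theory.
Import ComplexField.Normc.

Local Open Scope classical_set_scope.
Local Open Scope ring_scope.

(* The letter (i, false) is the i-th generator and (i, true) its inverse. *)
Definition letter (g : nat) := ('I_g * bool)%type.

Definition linv g (a : letter g) : letter g := (a.1, ~~ a.2).

Definition reduced g (w : seq (letter g)) : bool :=
  sorted (fun a b => b != linv a) w.

(* Left multiplication of a reduced word by a letter, with cancellation. *)
Definition cons_letter g (a : letter g) (w : seq (letter g)) :=
  if w is b :: w' then if b == linv a then w' else a :: w else [:: a].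

Definition reduce_cat g (v w : seq (letter g)) : seq (letter g) :=
  foldr (@cons_letter g) w v.

Record free_group (g : nat) := FreeGroup {
  word :> seq (letter g);
  word_reduced : reduced word }.

HB.instance Definition _ g := [isSub for @word g].
HB.instance Definition _ g := [Choice of free_group g by <:].

Section FreeGroup.
Variable g : nat.
Implicit Types (a b : letter g) (v w : seq (letter g)).

Lemma linvK : involutive (@linv g).
Proof. by case=> i b; rewrite /linv /= negbK. Qed.

Lemma reduced_behead a w : reduced (a :: w) -> reduced w.
Proof. by case: w => //= b w /andP[]. Qed.

Lemma reduced_cons_letter a w : reduced w -> reduced (cons_letter a w).
Proof.
case: w => //= b w rw; case: ifP => [_|nab]; last by rewrite /reduced /= nab.
exact: reduced_behead rw.
Qed.

Lemma reduced_reduce_cat v w : reduced w -> reduced (reduce_cat v w).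
Proof. by move=> rw; elim: v => //= a v; exact: reduced_cons_letter. Qed.

Lemma cons_letterE a w : reduced (a :: w) -> cons_letter a w = a :: w.
Proof. by case: w => //= b w /andP[/negbTE ->]. Qed.

Lemma cons_letterK a w :
  reduced w -> cons_letter (linv a) (cons_letter a w) = w.
Proof.
case: w => [|b w rw] /=; first by rewrite linvK eqxx.
case: ifPn => [/eqP ->|_] in rw *; last by rewrite /= linvK eqxx.
by rewrite cons_letterE// eqxx.
Qed.

Lemma reduce_cat_cons a v w :
  reduced v -> reduced w ->
  reduce_cat (cons_letter a v) w = cons_letter a (reduce_cat v w).
Proof.
case: v => //= b v rbv rw; case: ifP => //= /eqP ->.
rewrite -[X in cons_letter X](linvK a) cons_letterK //.
by apply: reduced_reduce_cat.
Qed.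

Lemma reduce_catA u v w : reduced v -> reduced w ->
  reduce_cat u (reduce_cat v w) = reduce_cat (reduce_cat u v) w.
Proof.
move=> rv rw; elim: u => //= a u ->; rewrite reduce_cat_cons //.
exact: reduced_reduce_cat.
Qed.

Lemma reduce_cats0 w : reduced w -> reduce_cat w [::] = w.
Proof.
elim: w => //= a w IH raw; rewrite IH ?cons_letterE //.
exact: reduced_behead raw.
Qed.

Definition winv w := rev (map (@linv g) w).

Lemma winvK : involutive winv.
Proof.
by move=> w; rewrite /winv map_rev revK -map_comp map_id_in // => a _; exact: linvK.
Qed.

Lemma reduced_winv w : reduced w -> reduced (winv w).
Proof.
rewrite /winv /reduced rev_sorted sorted_map.
by apply: sub_sorted => a b /=; rewrite eq_sym linvK; apply: contraNneq => ->.
Qed.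

Lemma reduce_catVK v w : reduced w -> reduce_cat (winv v) (reduce_cat v w) = w.
Proof.
move=> rw; elim: v => //= a v IH.
rewrite /winv /= rev_cons /reduce_cat foldr_rcons cons_letterK //.
exact: reduced_reduce_cat.
Qed.

Definition free_one : free_group g := @FreeGroup g [::] isT.
Definition free_mul (x y : free_group g) :=
  FreeGroup (reduced_reduce_cat x (word_reduced y)).
Definition free_inv (x : free_group g) :=
  FreeGroup (reduced_winv (word_reduced x)).

Lemma free_mulA : associative free_mul.
Proof.
by move=> x y z; apply: val_inj; rewrite /= reduce_catA //; exact: word_reduced.
Qed.
Lemma free_mul1 : left_id free_one free_mul.
Proof. by move=> x; apply: val_inj. Qed.
Lemma free_mulr1 : right_id free_one free_mul.
Proof. by move=> x; apply: val_inj; rewrite /= reduce_cats0 //; exact: word_reduced. Qed.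
Lemma free_mulV : left_inverse free_one free_inv free_mul.
Proof.
move=> x; apply: val_inj; rewrite /= -{2}(reduce_cats0 (word_reduced x)).
by rewrite reduce_catVK.
Qed.
Lemma free_mulrV : right_inverse free_one free_inv free_mul.
Proof.
move=> x; rewrite -[X in free_mul X](_ : free_inv (free_inv x) = x) ?free_mulV //.
by apply: val_inj; rewrite /= winvK.
Qed.

HB.instance Definition _ := isGroup.Build (free_group g)
  free_mulA free_mul1 free_mulr1 free_mulV free_mulrV.

Definition free_gen (i : 'I_g) : free_group g := @FreeGroup g [:: (i, false)] isT.

Lemma free_mul_cons a w (raw : reduced (a :: w)) (rw : reduced w) (ra : reduced [:: a]) :
  FreeGroup raw = (FreeGroup ra * FreeGroup rw)%g.
Proof. by apply: val_inj; rewrite /= cons_letterE. Qed.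

Lemma free_gen_inv (i : 'I_g) (ra : reduced [:: (i, true)]) :
  FreeGroup ra = ((free_gen i)^-1)%g.
Proof. exact: val_inj. Qed.

Lemma free_group_universal (H : groupType) (h : 'I_g -> H) :
  exists! phi : free_group g -> H,
    (forall x y, phi (x * y)%g = (phi x * phi y)%g) /\
    (forall i, phi (free_gen i) = h i).
Proof.
pose hl (a : letter g) := if a.2 then ((h a.1)^-1)%g else h a.1.
have hlV a : hl (linv a) = ((hl a)^-1)%g.
  by case: a => i []; rewrite /hl /linv /= ?invgK.
pose ev (w : seq (letter g)) := foldr (fun a y => hl a * y)%g 1%g w.
have ev_cons a w : ev (cons_letter a w) = (hl a * ev w)%g.
  case: w => //= b w; case: ifP => //= /eqP ->.
  by rewrite hlV mulgA mulgV mul1g.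
exists (fun x => ev (word x)); split; first split.
- move=> x y /=; elim: (word x) => /= [|a w IH]; first by rewrite mul1g.
  by rewrite ev_cons IH mulgA.
- by move=> i; rewrite /ev /= /hl /= mulg1.
move=> psi [psiM psi_gen]; apply/funext => -[w rw] /=.
have psi1 : psi 1%g = 1%g.
  by apply: (mulgI (psi 1%g)); rewrite -psiM !mulg1.
have psiV x : psi (x^-1)%g = ((psi x)^-1)%g.
  by apply: (mulgI (psi x)); rewrite -psiM !mulgV psi1.
elim: w rw => [|a w IH] raw /=.
  by rewrite -psi1; congr psi; apply: val_inj.
have rw := reduced_behead raw; have ra : reduced [:: a] by [].
rewrite (free_mul_cons raw rw ra) psiM -IH; congr (_ * _)%g.
case: a {raw} ra => i [] ra; rewrite /hl /=.
  by rewrite free_gen_inv psiV psi_gen.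
by rewrite -psi_gen; congr psi; apply: val_inj.
Qed.

End FreeGroup.

Section Ell2.
Variables (R : realType) (G : groupType).
Local Notation C := R[i].

Definition sqsum (f : G -> C) : \bar R :=
  \esum_(x in [set: G]) ((normc (f x)) ^+ 2)%:E.

Definition square_summable (f : G -> C) : bool := (sqsum f < +oo)%E.

Lemma normc_ge0 (z : C) : 0 <= normc z.
Proof. by case: z => a b; exact: sqrtr_ge0. Qed.

Lemma sqsum_ge0 f : (0 <= sqsum f)%E.
Proof. by apply: esum_ge0 => x _; rewrite lee_fin sqr_ge0. Qed.

Lemma sqsumD (f1 f2 : G -> C) :
  (sqsum (f1 + f2)%R
     <= (sqsum f1 + sqsum f1) + (sqsum f2 + sqsum f2))%E.
Proof.
have p0 (h : G -> C) x : (0 <= ((normc (h x)) ^+ 2)%:E)%E.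
  by rewrite lee_fin sqr_ge0.
rewrite /sqsum -!esumD//; try by move=> x _; rewrite adde_ge0.
apply: le_esum => x _; rewrite -!EFinD lee_fin.
have := le_normcD (f1 x) (f2 x); have := normc_ge0 (f1 x + f2 x).
rewrite -[(f1 + f2) x]/(f1 x + f2 x).
move: (normc (f1 x + f2 x)) (normc (f1 x)) (normc (f2 x)) => a b c a0 abc.
have h1 := sqr_ge0 (b - c).
have h2 : a ^+ 2 <= (b + c) ^+ 2 by rewrite ler_sqr ?nnegrE ?(le_trans a0 abc).
by nra.
Qed.

Lemma sqsumZ (c : C) (f : G -> C) : (sqsum (c *: f)%R <= ((normc c) ^+ 2)%:E * sqsum f)%E.
Proof.
apply: ge_ereal_sup => _ [X fX <-].
under eq_fsbigr do rewrite -[(c *: f) _]/(c * f _) normcM exprMn EFinM.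
rewrite -ge0_mule_fsumr; last by move=> x; rewrite lee_fin sqr_ge0.
apply: lee_wpmul2l; first by rewrite lee_fin sqr_ge0.
by apply: ereal_sup_ubound; exists X.
Qed.

Lemma sqsum0 : sqsum 0 = 0%E.
Proof. by apply: esum1 => x _; rewrite [X in normc X](_ : _ = 0)// normc0 expr0n. Qed.

Lemma square_summable_submod : submod_closed square_summable.
Proof.
split; first by rewrite -topredE /= /square_summable sqsum0 ltry.
move=> c f1 f2; rewrite -!topredE /= /square_summable => s1 s2.
apply: le_lt_trans (sqsumD _ _) _.
have s3 : (sqsum (c *: f1)%R < +oo)%E.
  apply: le_lt_trans (sqsumZ _ _) _.
  by rewrite lte_mul_pinfty ?lee_fin ?sqr_ge0.
by rewrite !lte_add_pinfty.
Qed.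

HB.instance Definition _ :=
  GRing.isSubmodClosed.Build C (G -> C) square_summable square_summable_submod.

Record ell2 := Ell2 {
  ell2_fun :> G -> C;
  ell2P : square_summable ell2_fun }.

HB.instance Definition _ := [isSub for ell2_fun].
HB.instance Definition _ := [Choice of ell2 by <:].
HB.instance Definition _ := [SubChoice_isSubLmodule of ell2 by <:].

Definition l2norm (f : ell2) : R := Num.sqrt (fine (sqsum f)).

Implicit Types f : ell2.

Lemma sqsum_fin f : sqsum f \is a fin_num.
Proof. by rewrite ge0_fin_numE ?sqsum_ge0//; exact: ell2P. Qed.

Lemma l2norm_ge0 f : 0 <= l2norm f.
Proof. exact: sqrtr_ge0. Qed.

Lemma sqr_l2norm f : l2norm f ^+ 2 = fine (sqsum f).
Proof. by rewrite sqr_sqrtr // fine_ge0 // sqsum_ge0. Qed.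

(* The sharp constant is 1; this crude form is all the closure proofs below
   need. *)
Lemma l2normD_le f1 f2 : l2norm (f1 + f2) <= 2 * (l2norm f1 + l2norm f2).
Proof.
rewrite -ler_sqr ?nnegrE ?mulr_ge0 ?addr_ge0 ?l2norm_ge0 //.
have h1 : l2norm (f1 + f2) ^+ 2 <=
    (l2norm f1 ^+ 2 + l2norm f1 ^+ 2) + (l2norm f2 ^+ 2 + l2norm f2 ^+ 2).
  rewrite !sqr_l2norm -!fineD ?fin_numD ?sqsum_fin //.
  rewrite fine_le ?fin_numD ?sqsum_fin //; exact: sqsumD.
have h2 := mulr_ge0 (l2norm_ge0 f1) (l2norm_ge0 f2).
have := sqr_ge0 (l2norm f1); have := sqr_ge0 (l2norm f2).
by nra.
Qed.

Lemma l2normZ_le (c : C) f : l2norm (c *: f) <= normc c * l2norm f.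
Proof.
rewrite -ler_sqr ?nnegrE ?mulr_ge0 ?normc_ge0 ?l2norm_ge0 //.
rewrite exprMn !sqr_l2norm -[_ ^+ 2]/(fine (_ ^+ 2)%:E) -fineM ?sqsum_fin //.
rewrite fine_le ?fin_numM ?sqsum_fin //; exact: sqsumZ.
Qed.

Definition bounded_by (M : R) (T : ell2 -> ell2) :=
  forall f, l2norm (T f) <= M * l2norm f.

Definition bounded_linear (T : ell2 -> ell2) : bool :=
  `[< linear T /\ exists M : R, bounded_by M T >].

Lemma bounded_byW M (T : ell2 -> ell2) :
  bounded_by M T -> bounded_by `|M| T.
Proof.
move=> bT f; apply: le_trans (bT f) _.
by rewrite ler_wpM2r ?l2norm_ge0 ?ler_norm.
Qed.

Lemma bounded_byD M1 M2 (T1 T2 : ell2 -> ell2) :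
  bounded_by M1 T1 -> bounded_by M2 T2 ->
  bounded_by (2 * (M1 + M2)) (T1 + T2).
Proof.
move=> b1 b2 f; apply: le_trans (l2normD_le _ _) _.
by rewrite -mulrA ler_pM2l // mulrDl lerD.
Qed.

Lemma bounded_byZ (c : C) M (T : ell2 -> ell2) :
  bounded_by M T -> bounded_by (normc c * M) (c *: T).
Proof.
move=> bT f; apply: le_trans (l2normZ_le _ _) _.
by rewrite -mulrA ler_wpM2l ?normc_ge0.
Qed.

Lemma bounded_by_comp M1 M2 (T1 T2 : ell2 -> ell2) : 0 <= M1 ->
  bounded_by M1 T1 -> bounded_by M2 T2 -> bounded_by (M1 * M2) (T1 \o T2).
Proof.
move=> M1p b1 b2 f /=; apply: le_trans (b1 _) _.
by rewrite -mulrA ler_wpM2l.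
Qed.

Lemma l2norm0 : l2norm 0 = 0.
Proof. by rewrite /l2norm sqsum0 sqrtr0. Qed.

Lemma bounded_linear_submod : submod_closed bounded_linear.
Proof.
split.
  apply/asboolP; split; first by move=> a u v; rewrite scaler0 addr0.
  by exists 0 => f; rewrite mul0r [_ f]/(0 : ell2) l2norm0.
move=> c T1 T2 /asboolP[l1 [M1 b1]] /asboolP[l2 [M2 b2]].
apply/asboolP; split.
  move=> a u v; rewrite -[LHS]/(c *: T1 (a *: u + v) + T2 (a *: u + v)).
  rewrite l1 l2 -[(c *: T1 + T2) u]/(c *: T1 u + T2 u).
  rewrite -[(c *: T1 + T2) v]/(c *: T1 v + T2 v) !scalerDr !scalerA mulrC.
  by rewrite addrACA.
by eexists; apply: bounded_byD b2; exact: bounded_byZ b1.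
Qed.

HB.instance Definition _ := GRing.isSubmodClosed.Build C (ell2 -> ell2)
  bounded_linear bounded_linear_submod.

Record bounded_op := BoundedOp {
  op_fun :> ell2 -> ell2;
  op_bounded_linear : bounded_linear op_fun }.

HB.instance Definition _ := [isSub for op_fun].
HB.instance Definition _ := [Choice of bounded_op by <:].
HB.instance Definition _ := [SubChoice_isSubLmodule of bounded_op by <:].

Implicit Types S T : bounded_op.

Lemma op_linear T : linear T.
Proof. by have /asboolP[] := op_bounded_linear T. Qed.

Lemma op_bound T : exists2 M : R, 0 <= M & bounded_by M T.
Proof.
have /asboolP[_ [M bM]] := op_bounded_linear T.
by exists `|M|; [exact: normr_ge0|exact: bounded_byW].
Qed.

Lemma op_id_proof : bounded_linear id.
Proof. by apply/asboolP; split=> //; exists 1 => f; rewrite mul1r. Qed.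

Lemma op_comp_proof S T : bounded_linear (S \o T).
Proof.
apply/asboolP; split; first by move=> a u v /=; rewrite !op_linear.
have [M M0 bM] := op_bound S; have [N N0 bN] := op_bound T.
by exists (M * N); exact: bounded_by_comp.
Qed.

Definition op_one := BoundedOp op_id_proof.
Definition op_mul S T := BoundedOp (op_comp_proof S T).

Lemma op_addE S T f : (S + T) f = S f + T f. Proof. by []. Qed.
Lemma op_scaleE (c : C) T f : (c *: T) f = c *: T f. Proof. by []. Qed.

Lemma op_eqP S T : (forall f, S f = T f) -> S = T.
Proof. by move=> ST; apply: val_inj; apply/funext. Qed.

Lemma op_mulA : associative op_mul.
Proof. by move=> S T U; exact: op_eqP. Qed.
Lemma op_mul1 : left_id op_one op_mul.
Proof. by move=> T; exact: op_eqP. Qed.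
Lemma op_mulr1 : right_id op_one op_mul.
Proof. by move=> T; exact: op_eqP. Qed.
Lemma op_mulDl : left_distributive op_mul +%R.
Proof. by move=> S T U; exact: op_eqP. Qed.
Lemma op_mulDr : right_distributive op_mul +%R.
Proof.
move=> S T U; apply: op_eqP => f; rewrite op_addE /=.
by have := op_linear S 1 (T f) (U f); rewrite !scale1r.
Qed.

Definition delta_fun (x : G) : G -> C := fun y => (y == x)%:R.

Lemma delta_square_summable x : square_summable (delta_fun x).
Proof.
rewrite /square_summable /sqsum (esumID [set x]); last first.
  by move=> y _; rewrite lee_fin sqr_ge0.
rewrite setTI esum_set1 ?lee_fin ?sqr_ge0 //.
rewrite esum1 ?adde0 ?ltry // => y [_ /= /eqP/negbTE nyx].
by rewrite /delta_fun nyx normc0 expr0n.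
Qed.

Definition delta (x : G) : ell2 := Ell2 (delta_square_summable x).

Lemma op_one_neq0 : op_one != 0.
Proof.
apply/eqP => /(congr1 (fun T : bounded_op => (T (delta 1%g) : G -> C) 1%g)) /=.
by rewrite /delta_fun eqxx => /eqP; rewrite oner_eq0.
Qed.

HB.instance Definition _ := GRing.Zmodule_isNzRing.Build bounded_op
  op_mulA op_mul1 op_mulr1 op_mulDl op_mulDr op_one_neq0.

Lemma op_mulE S T f : (S * T) f = S (T f). Proof. by []. Qed.
Lemma op_oneE f : (1 : bounded_op) f = f. Proof. by []. Qed.

Lemma op_scalerAl (c : C) S T : c *: (S * T) = c *: S * T.
Proof. exact: op_eqP. Qed.

HB.instance Definition _ := GRing.Lmodule_isLalgebra.Build C bounded_op op_scalerAl.

Lemma op_scalerAr (c : C) S T : c *: (S * T) = S * (c *: T).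
Proof.
apply: op_eqP => f; rewrite op_mulE !op_scaleE op_mulE.
have S0 : S 0 = 0.
  have := op_linear S 1 0 0; rewrite !scale1r addr0 => h.
  by apply: (addIr (S 0)); rewrite -h add0r.
by have := op_linear S c (T f) 0; rewrite S0 !addr0.
Qed.

HB.instance Definition _ := GRing.Lalgebra_isAlgebra.Build C bounded_op op_scalerAr.

Definition translate (x : G) (h : G -> C) : G -> C := fun y => h (x^-1 * y)%g.

Lemma sqsum_translate x h : sqsum (translate x h) = sqsum h.
Proof.
rewrite /sqsum [RHS](@reindex_esum R G G setT setT (fun y => x^-1 * y)%g) //.
split=> //; first by move=> a b _ _ /mulgI.
by move=> y _; exists (x * y)%g => //; rewrite mulKg.
Qed.

Lemma translate_square_summable x f : square_summable (translate x f).
Proof. by rewrite /square_summable sqsum_translate; exact: ell2P. Qed.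

Definition lambda_fun x f : ell2 := Ell2 (translate_square_summable x f).

Lemma lambda_bounded_linear x : bounded_linear (lambda_fun x).
Proof.
apply/asboolP; split.
  by move=> a u v; apply: val_inj; apply/funext.
by exists 1 => f; rewrite mul1r /l2norm sqsum_translate.
Qed.

Definition lambda (x : G) : bounded_op := BoundedOp (lambda_bounded_linear x).

Lemma lambda1 : lambda 1%g = 1.
Proof.
apply: op_eqP => f; apply: val_inj; apply/funext => y /=.
by rewrite /translate invg1 mul1g.
Qed.

Lemma lambdaM x y : lambda (x * y)%g = lambda x * lambda y.
Proof.
apply: op_eqP => f; apply: val_inj; apply/funext => z /=.
by rewrite /translate invgM mulgA.
Qed.

(* lambda(C[G]); as lambda(x)^* = lambda(x^-1), it is a unital *-algebra. *)
Definition lambda_span : set bounded_op :=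
  [set \sum_(p <- s) p.1 *: lambda p.2 | s in [set: seq (C * G)]].

(* Membership in the operator-norm closure of lambda(C[G]), that is, in the
   C*-algebra generated by lambda(G). *)
Definition in_cstar_red (T : bounded_op) : bool :=
  `[< forall e : R, 0 < e ->
      exists2 S, lambda_span S & bounded_by e (T - S) >].

Lemma lambda_span_lambda x : lambda_span (lambda x).
Proof. by exists [:: (1, x)] => //; rewrite big_seq1 scale1r. Qed.

Lemma lambda_span_lin (c : C) S T :
  lambda_span S -> lambda_span T -> lambda_span (c *: S + T).
Proof.
move=> [s _ <-] [t _ <-].
exists ([seq (c * p.1, p.2) | p <- s] ++ t) => //.
rewrite big_cat big_map /= scaler_sumr; congr (_ + _).
by apply: eq_bigr => p _; rewrite scalerA.
Qed.

Lemma lambda_span_mul S T :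
  lambda_span S -> lambda_span T -> lambda_span (S * T).
Proof.
move=> [s _ <-] [t _ <-].
exists [seq (p.1 * q.1, (p.2 * q.2)%g) | p <- s, q <- t] => //.
rewrite big_allpairs_dep /= mulr_suml; apply: eq_bigr => p _.
rewrite mulr_sumr; apply: eq_bigr => q _ /=.
by rewrite lambdaM -scalerAl -scalerAr scalerA.
Qed.

Lemma lambda_span_in_cstar S : lambda_span S -> in_cstar_red S.
Proof.
move=> SS; apply/asboolP => e e0; exists S => // f.
by rewrite subrr [_ f]/(0 : ell2) l2norm0 mulr_ge0 ?l2norm_ge0 ?ltW.
Qed.

Lemma bounded_byS M N (T : ell2 -> ell2) :
  M <= N -> bounded_by M T -> bounded_by N T.
Proof.
by move=> MN bT f; apply: le_trans (bT f) _; rewrite ler_wpM2r ?l2norm_ge0.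
Qed.

Lemma in_cstar_red_subalg : subalg_closed in_cstar_red.
Proof.
split.
- by apply: lambda_span_in_cstar; rewrite -lambda1; exact: lambda_span_lambda.
- move=> c T1 T2 /asboolP h1 /asboolP h2; apply/asboolP => e e0.
  have c1 : 0 < normc c + 1 by rewrite ltr_wpDl ?normc_ge0.
  have [|S1 s1 b1] := h1 (e / 4 / (normc c + 1)); first by rewrite !divr_gt0.
  have [|S2 s2 b2] := h2 (e / 4); first by rewrite divr_gt0.
  exists (c *: S1 + S2); first exact: lambda_span_lin.
  rewrite (_ : _ - _ = c *: (T1 - S1) + (T2 - S2)); last first.
    by rewrite scalerBr opprD addrACA.
  apply: bounded_byS (bounded_byD (bounded_byZ c b1) b2).
  have : normc c * (e / 4 / (normc c + 1)) <= e / 4.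
    rewrite mulrA ler_pdivrMr // mulrC ler_pM2l ?divr_gt0 //.
    by rewrite lerDl.
  lra.
move=> T1 T2 /asboolP h1 /asboolP h2; apply/asboolP => e e0.
have [M M0 bM] := op_bound T2.
have M1 : 0 < M + 1 by rewrite ltr_wpDl.
have [|S1 s1 b1] := h1 (e / 4 / (M + 1)); first by rewrite !divr_gt0.
have [N N0 bN] := op_bound S1.
have N1 : 0 < N + 1 by rewrite ltr_wpDl.
have [|S2 s2 b2] := h2 (e / 4 / (N + 1)); first by rewrite !divr_gt0.
exists (S1 * S2); first exact: lambda_span_mul.
rewrite (_ : _ - _ = (T1 - S1) * T2 + S1 * (T2 - S2)); last first.
  by rewrite mulrBl mulrBr addrA subrK.
have b3 := bounded_by_comp _ b1 bM; have b4 := bounded_by_comp N0 bN b2.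
apply: bounded_byS (bounded_byD (b3 _) b4); last by rewrite !divr_ge0 ?ltW.
have : e / 4 / (M + 1) * M <= e / 4.
  by rewrite mulrAC ler_pdivrMr // ler_pM2l ?divr_gt0 // lerDl.
have : N * (e / 4 / (N + 1)) <= e / 4.
  by rewrite mulrA ler_pdivrMr // mulrC ler_pM2l ?divr_gt0 // lerDl.
lra.
Qed.

HB.instance Definition _ := GRing.isSubalgClosed.Build C bounded_op
  in_cstar_red (GRing.subalg_closed_semi in_cstar_red_subalg).

Record cstar_red := CstarRed {
  cstar_op :> bounded_op;
  cstar_redP : in_cstar_red cstar_op }.

HB.instance Definition _ := [isSub for cstar_op].
HB.instance Definition _ := [Choice of cstar_red by <:].
HB.instance Definition _ := [SubChoice_isSubAlgebra of cstar_red by <:].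

Definition cstar_lambda (x : G) : cstar_red :=
  CstarRed (lambda_span_in_cstar (lambda_span_lambda x)).

End Ell2.

Definition free_haar (R : realType) (g : nat) (j : 'I_g) :
  cstar_red R (free_group g) := cstar_lambda R (free_gen j).

Section Spectrum.
Variable R : realType.
Local Notation C := R[i].

(* [iota] is the embedding of the scalars z |-> z 1 in the unital ring [A]. *)
Definition spectrum (A : pzRingType) (iota : C -> A) (a : A) : set C :=
  [set z | ~ exists b, (iota z - a) * b = 1 /\ b * (iota z - a) = 1].

(* [sup] is 0 on the empty set; the spectrum is empty only in the zero ring,
   i.e. for matrices of size 0. *)
Definition spectral_radius (A : pzRingType) (iota : C -> A) (a : A) : R :=
  sup [set normc z | z in spectrum iota a].

Definition mx_spectral_radius n (M : 'M[C]_n) : R :=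
  spectral_radius (@scalar_mx C n) M.

(* The tensor product M_k(C) (x) A is identified with the algebra M_k(A) of
   k x k matrices over A, in which X (x) a has entries X_ij a. *)
Definition tens_elt (A : algType C) k (X : 'M[C]_k) (a : A) : 'M[A]_k :=
  \matrix_(i, j) (X i j *: a).

Definition tens_spectral_radius (A : algType C) k (T : 'M[A]_k) : R :=
  spectral_radius (fun z => (z%:A)%:M) T.

End Spectrum.

(* Main.v *)
Require Import Defs.
From HB Require Import structures.
From mathcomp Require Import all_boot all_order all_algebra.
From mathcomp Require Import all_classical all_reals ereal esum.
From mathcomp Require Import finmap complex mxtens.
From mathcomp Require Import zify ring lra.

Set Implicit Arguments.
Unset Strict Implicit.
Unset Printing Implicit Defensive.

Import Order.TTheory GRing.Theory Num.Theory.
Import ComplexField.Normc.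

Local Open Scope classical_set_scope.
Local Open Scope ring_scope.

(** Write [T] for the operator, [M] for the matrix [\sum_j X_j (x) conj X_j] and
[rho] for its spectral radius.  Both [T ^+ n] and [M ^+ n] expand over the
words [w] of length [n] in the indices: with [X_w] the product of the matrices
along [w],
  [(T ^+ n)_ij = \sum_w (X_w)_ij lambda(w)] and
  [(M ^+ n)_(ii')(jj') = \sum_w (X_w)_ij conj (X_w)_i'j'].
So the diagonal entry [(ii)(jj)] of [M ^+ n] is the squared l2 norm of the
coefficients of [(T ^+ n)_ij], its [energy], and everything reduces to
comparing operator norms with l2 norms of coefficients.

Upper bound.  If [|z|^2 > r > rho] then the energies are O(r^n), by
Cayley-Hamilton ([mx_power_growth]).  For a combination of positive words of
length [n], Haagerup's inequality bounds the operator norm by [n + 1] times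
the l2 norm of the coefficients ([haagerup_convol]); hence the entries of
[(T / z) ^+ n] decay geometrically, the Neumann series converges in the matrices
over the reduced C*-algebra ([neumann_inverse]) and [z] is not in the spectrum
([outside_spectrum]).

Lower bound.  If [rho > 0], the point [z = sqrt rho] itself is in the spectrum
([sqrt_radius_in_spectrum]), so no resolvent analyticity is involved.  A left
inverse [B] of [1 - T / z] would give
  [\sum_(n < N) (T / z) ^+ n = B (1 - (T / z) ^+ N)].
Apply both sides to the basis vector at the unit of the group.  On the left,
distinct words land on distinct basis vectors, so the squared norms add up: with
[c n] the total energy at length [n] divided by [rho ^+ n], one gets
[\sum_(n < N) c n <= K (1 + c N)] for a constant [K].  Cauchy-Schwarz and an
eigenvector of [M] for an eigenvalue of modulus [rho] keep [c n] away from 0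
([total_energy_ge]), so this inequality forces [c] to grow exponentially, whereas
[mx_power_growth] makes its growth subexponential ([exponential_gap]). *)

(** * Moduli, Cauchy-Schwarz and geometric estimates *)

Section ComplexModulus.
Variable R : realType.
Local Notation C := R[i].
Implicit Types (z : C) (n : nat).

Lemma normcX z n : normc (z ^+ n) = normc z ^+ n.
Proof. by elim: n => [|n IH]; rewrite ?normc1// !exprS normcM IH. Qed.

Lemma normc_triangle z1 z2 : normc (z1 + z2) <= normc z1 + normc z2.
Proof. exact: le_normcD. Qed.

Lemma normc_opp z : normc (- z) = normc z.
Proof. exact: normcN. Qed.

Lemma normc_sum_le (I : Type) (s : seq I) (F : I -> C) :
  normc (\sum_(i <- s) F i) <= \sum_(i <- s) normc (F i).
Proof.
elim: s => [|i s IH]; first by rewrite !big_nil normc0.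
rewrite !big_cons; apply: le_trans (normc_triangle _ _) _; exact: lerD.
Qed.

(** Lagrange's identity: the difference of the two sides is half the sum of the
squares [(x i * y j - x j * y i) ^+ 2]. *)
Lemma cauchy_schwarz_seq (I : Type) (s : seq I) (x y : I -> R) :
  (\sum_(i <- s) x i * y i) ^+ 2 <=
  (\sum_(i <- s) x i ^+ 2) * (\sum_(i <- s) y i ^+ 2).
Proof.
have h : 0 <= \sum_(i <- s) \sum_(j <- s) (x i * y j - x j * y i) ^+ 2.
  by apply: sumr_ge0 => i _; apply: sumr_ge0 => j _; exact: sqr_ge0.
have e : \sum_(i <- s) \sum_(j <- s) (x i * y j - x j * y i) ^+ 2 =
   (\sum_(i <- s) x i ^+ 2) * (\sum_(i <- s) y i ^+ 2) *+ 2
   - (\sum_(i <- s) x i * y i) ^+ 2 *+ 2.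
  rewrite [X in X *+ 2 - _](_ : _ =
      \sum_(i <- s) \sum_(j <- s) x i ^+ 2 * y j ^+ 2); last first.
    by rewrite mulr_suml; apply: eq_bigr => i _; rewrite mulr_sumr.
  rewrite [(\sum_(i <- s) x i * y i) ^+ 2](_ : _ =
      \sum_(i <- s) \sum_(j <- s) x i * y i * (x j * y j)); last first.
    by rewrite expr2 mulr_suml; apply: eq_bigr => i _; rewrite mulr_sumr.
  rewrite mulr2n [X in _ + X - _]exchange_big -big_split /= -sumrMnl -sumrB.
  apply: eq_bigr => i _; rewrite -big_split -sumrMnl -sumrB /=.
  by apply: eq_bigr => j _; ring.
move: h; rewrite e; lra.
Qed.

Lemma cauchy_schwarz_normc (I : Type) (s : seq I) (a b : I -> C) :
  normc (\sum_(i <- s) a i * b i) ^+ 2 <=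
  (\sum_(i <- s) normc (a i) ^+ 2) * (\sum_(i <- s) normc (b i) ^+ 2).
Proof.
have := cauchy_schwarz_seq s (fun i => normc (a i)) (fun i => normc (b i)).
apply: le_trans.
have h0 := normc_ge0 (\sum_(i <- s) a i * b i).
have h : normc (\sum_(i <- s) a i * b i) <= \sum_(i <- s) normc (a i) * normc (b i).
  apply: le_trans (normc_sum_le _ _) _.
  by apply: ler_sum => i _; rewrite normcM.
by rewrite ler_sqr ?nnegrE ?(le_trans h0 h).
Qed.

Lemma mulr_conjc z : z * conjc z = ((normc z) ^+ 2)%:C%C.
Proof.
case: z => a b; rewrite /= sqr_sqrtr ?addr_ge0 ?sqr_ge0 //.
by apply/eqP; rewrite eq_complex /=; apply/andP; split; apply/eqP; ring.
Qed.

Lemma normc_conjc z : normc (conjc z) = normc z.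
Proof. by case: z => a b; rewrite /= sqrrN. Qed.

Lemma normc_real (x : R) : normc x%:C%C = `|x|.
Proof. by rewrite /= expr0n addr0 sqrtr_sqr. Qed.

Lemma normc_invX_sqr z n : normc (z^-1 ^+ n) ^+ 2 = (normc z ^+ 2)^-1 ^+ n.
Proof. by rewrite normcX normcV -exprVn -!exprM mulnC. Qed.

(** Summed pointwise with a well-chosen [t], this replaces the triangle
inequality of the l2 norm while staying within squared norms. *)
Lemma normc_sqrD_weighted (t : R) (x y : C) : 0 < t ->
  normc (x + y) ^+ 2 <= ((t + 1) / t) * normc x ^+ 2 + (t + 1) * normc y ^+ 2.
Proof.
move=> t0; have := normc_triangle x y.
move: (normc _) (normc_ge0 (x + y)) (normc x) (normc y) => s s0 u v h.
have h1 : s ^+ 2 <= (u + v) ^+ 2 by rewrite ler_sqr ?nnegrE // (le_trans s0).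
apply: le_trans h1 _; rewrite -subr_ge0.
have -> : (t + 1) / t * u ^+ 2 + (t + 1) * v ^+ 2 - (u + v) ^+ 2
  = (u - t * v) ^+ 2 / t by field; rewrite gt_eqF.
by rewrite divr_ge0 ?sqr_ge0 // ltW.
Qed.

Lemma normc_le_ReIm z : normc z <= `|complex.Re z| + `|complex.Im z|.
Proof.
case: z => a b /=; rewrite -[leRHS]ger0_norm ?addr_ge0 // -sqrtr_sqr.
rewrite ler_wsqrtr // sqrrD !real_normK ?num_real // lerD2r lerDl.
by rewrite mulrn_wge0 // mulr_ge0.
Qed.

Lemma normRe_le z : `|complex.Re z| <= normc z.
Proof. by case: z => a b /=; rewrite -sqrtr_sqr ler_wsqrtr // lerDl sqr_ge0. Qed.

Lemma normIm_le z : `|complex.Im z| <= normc z.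
Proof. by case: z => a b /=; rewrite -sqrtr_sqr ler_wsqrtr // lerDr sqr_ge0. Qed.

End ComplexModulus.

Section GeometricGrowth.
Variable R : realType.

Lemma geometric_recursion (y : nat -> R) (l r D : R) :
  0 <= l -> l < r -> 0 <= D -> (forall n, y n.+1 <= l * y n + D * r ^+ n) ->
  exists2 E, 0 <= E & forall n, y n <= E * r ^+ n.
Proof.
move=> l0 lr D0 rec; have rl : 0 < r - l by rewrite subr_gt0.
have r0 : 0 <= r by rewrite ltW // (le_lt_trans l0).
exists (`|y 0%N| + D / (r - l)); first by rewrite addr_ge0 ?divr_ge0 // ltW.
elim=> [|n IH].
  by rewrite expr0 mulr1 (le_trans (ler_norm _)) // lerDl divr_ge0 // ltW.
apply: le_trans (rec n) _.
set E := `|y 0%N| + _ in IH *.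
have DE : D <= (r - l) * E.
  rewrite /E mulrDr mulrCA mulfV ?gt_eqF // mulr1 lerDr.
  by rewrite mulr_ge0 // ltW.
have := exprn_ge0 n r0; rewrite exprS; move: (r ^+ n) IH => p IH p0.
have h1 : l * y n <= l * (E * p) by rewrite ler_wpM2l.
have h2 : D * p <= (r - l) * E * p by rewrite ler_wpM2r.
by lra.
Qed.

Lemma unbounded_expr (q B : R) : 1 < q -> exists n, B < q ^+ n.
Proof.
move=> q1; have q0 : 0 < q - 1 by rewrite subr_gt0.
have bern n : 1 + n%:R * (q - 1) <= q ^+ n.
  elim: n => [|n IH]; first by rewrite mul0r addr0 expr0.
  rewrite exprS; have nq : 0 <= n%:R * (q - 1) by rewrite mulr_ge0 ?ler0n ?ltW.
  have : q * (1 + n%:R * (q - 1)) <= q * q ^+ n by rewrite ler_wpM2l // ltW // (lt_trans ltr01).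
  rewrite -natr1; nra.
exists (Num.truncn (`|B| / (q - 1))).+1.
apply: lt_le_trans (bern _).
have := truncnS_gt (`|B| / (q - 1)).
rewrite ltr_pdivrMr // => h; have := ler_norm B; lra.
Qed.

Lemma linear_lt_expr (q : R) : 1 < q ->
  exists2 D, 0 <= D & forall n, n.+1%:R <= D * q ^+ n.
Proof.
move=> q1; have q0 : 0 < q - 1 by rewrite subr_gt0.
have q10 : 0 < q := lt_trans ltr01 q1.
apply: (@geometric_recursion (fun n => n.+1%:R) 1 q 1) => // n.
rewrite !mul1r -[n.+2%:R]natr1 lerD2l.
elim: n => [|n IH]; rewrite ?expr0 // exprS (le_trans IH) //.
by rewrite ler_peMl ?ltW ?exprn_gt0.
Qed.

(** The partial sums [s] satisfy [s N.+1 - K >= (1 + 1 / K) (s N - K)]; being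
unbounded they eventually exceed [K], and from then on grow like
[(1 + 1 / K) ^+ N], faster than the subexponential bound on [c] allows. *)
Lemma exponential_gap (c : nat -> R) (K e : R) : 0 < K -> 0 < e ->
  (forall n, e <= c n) ->
  (forall t, 1 < t -> exists2 D, 0 <= D & forall n, c n <= D * t ^+ n) ->
  ~ forall N, \sum_(n < N) c n <= K * (1 + c N).
Proof.
move=> K0 e0 ce ct hK; pose s N := \sum_(n < N) c n.
have sS N : s N.+1 = s N + c N by rewrite /s big_ord_recr.
pose kap := K^-1; have kap0 : 0 < kap by rewrite invr_gt0.
have Kk : kap * K = 1 by rewrite mulVf // gt_eqF.
have step N : (1 + kap) * (s N - K) <= s N.+1 - K.
  have : kap * s N <= kap * (K * (1 + c N)) by rewrite ler_wpM2l ?hK // ltW.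
  rewrite mulrA Kk sS; lra.
have sN N : e * N%:R <= s N.
  elim: N => [|N IH]; first by rewrite /s big_ord0 mulr0.
  by rewrite sS -natr1 mulrDr mulr1 lerD.
pose N0 := (Num.truncn (K / e)).+1.
have d0 : 0 < s N0 - K.
  rewrite subr_gt0; apply: lt_le_trans (sN N0).
  by rewrite mulrC -ltr_pdivrMr // truncnS_gt.
set d := s N0 - K in d0.
have grow m : (1 + kap) ^+ m * d <= s (N0 + m)%N - K.
  elim: m => [|m IH]; first by rewrite expr0 mul1r addn0.
  rewrite addnS exprS -mulrA; apply: le_trans (step _).
  by rewrite ler_wpM2l // addr_ge0 // ltW.
(* Any [t] with [1 < t < 1 + kap] separates the two growth rates. *)
pose t := 1 + kap / 2; have t1 : 1 < t by rewrite ltrDl divr_gt0.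
have t0 : 0 < t := lt_trans ltr01 t1.
have [D D0 hD] := ct t t1.
have [|m hm] := @unbounded_expr ((1 + kap) / t) (K * D * t ^+ N0 / d).
  by rewrite ltr_pdivlMr // mul1r /t; lra.
move: hm; rewrite ltr_pdivrMr // expr_div_n [ltRHS]mulrAC ltr_pdivlMr ?exprn_gt0 //.
rewrite ltNge => /negP; apply; apply: le_trans (grow m) _.
rewrite lerBlDl; apply: le_trans (hK _) _.
rewrite mulrDr mulr1 lerD2l -!mulrA ler_wpM2l ?(ltW K0) //.
by rewrite -exprD hD.
Qed.

End GeometricGrowth.

(** * Growth of matrix powers *)

Section MatrixSpectralRadius.
Variable R : realType.
Local Notation C := R[i].

Lemma spectrum_mxE n (M : 'M[C]_n) z :
  spectrum (@scalar_mx C n) M z <-> eigenvalue M z.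
Proof.
split; last first.
  move=> /eigenvalueP[v vM v0] [b [hb _]].
  move: v0; rewrite -[v]mulmx1 -[X in v *m X]hb mulmxA mulmxBr vM.
  by rewrite mul_mx_scalar subrr mul0mx eqxx.
apply: contra_notT; rewrite /eigenvalue negbK kermx_eq0 row_free_unit => u.
exists (- invmx (M - z%:M)).
rewrite -opprB !mulrNN; split; [exact: mulmxV|exact: mulVmx].
Qed.

Lemma finite_max_normc (s : seq C) : s != [::] ->
  exists2 z, z \in s & forall y, y \in s -> normc y <= normc z.
Proof.
elim: s => // z s IH _; have [->|/IH[y ys hy]] := eqVneq s [::].
  by exists z; [exact: mem_head|move=> y; rewrite inE => /eqP ->].
have [zy|yz] := leP (normc z) (normc y).
  by exists y; [rewrite inE ys orbT|move=> x; rewrite inE => /predU1P[->//|/hy]].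
exists z; first exact: mem_head.
by move=> x; rewrite inE => /predU1P[->//|/hy h]; exact: le_trans h (ltW yz).
Qed.

Lemma char_poly_roots n (M : 'M[C]_n) :
  {s : seq C | char_poly M = \prod_(z <- s) ('X - z%:P)}.
Proof.
have [s e] := closed_field_poly_normal (char_poly M); exists s.
by rewrite e (eqP (char_poly_monic M)) scale1r.
Qed.

(** The supremum is attained because the spectrum is the finite set of roots
of the characteristic polynomial. *)
Lemma mx_spectral_radiusP n (M : 'M[C]_n) :
  (forall z, eigenvalue M z -> normc z <= mx_spectral_radius M) /\
  ((0 < n)%N -> exists2 z, eigenvalue M z & normc z = mx_spectral_radius M).
Proof.
have [s e] := char_poly_roots M.
have es z : eigenvalue M z = (z \in s).
  by rewrite eigenvalue_root_char e root_prod_XsubC.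
have [s0|/finite_max_normc[z zs zmax]] := eqVneq s [::].
  split=> [z|n0]; first by rewrite es s0.
  have := size_char_poly M; rewrite e s0 big_nil size_poly1 => -[] n0'.
  by rewrite -n0' in n0.
have ->: mx_spectral_radius M = normc z.
  have zmem : [set normc y | y in spectrum (@scalar_mx C n) M] (normc z).
    by exists z => //; apply/spectrum_mxE; rewrite es.
  have zub : ubound [set normc y | y in spectrum (@scalar_mx C n) M] (normc z).
    by move=> _ [y ysp <-]; apply: zmax; rewrite -es; exact/spectrum_mxE.
  apply/eqP; rewrite eq_le; apply/andP; split.
    by apply: ge_sup => //; exists (normc z).
  by apply: ub_le_sup => //; exists (normc z).
by split=> [y|_]; [rewrite es; exact: zmax|exists z; rewrite ?es].
Qed.

Lemma mx_spectral_radius_size0 (M : 'M[C]_0) : mx_spectral_radius M = 0.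
Proof.
rewrite /mx_spectral_radius /spectral_radius (_ : [set _ | _ in _] = set0) ?sup0 //.
apply/seteqP; split=> // x [z zsp _].
have /spectrum_mxE/eigenvalueP[v _] := zsp.
by rewrite (thinmx0 v) eqxx.
Qed.

Lemma mx_spectral_radius_gt0_size n (M : 'M[C]_n) :
  0 < mx_spectral_radius M -> (0 < n)%N.
Proof. by case: n M => // M; rewrite mx_spectral_radius_size0 ltxx. Qed.

Lemma mx_spectral_radius_ge0 n (M : 'M[C]_n) : 0 <= mx_spectral_radius M.
Proof.
case: n M => [|n] M; first by rewrite mx_spectral_radius_size0.
by have [_ /(_ isT)[z _ <-]] := mx_spectral_radiusP M; exact: normc_ge0.
Qed.

Lemma horner_mx_prod n (M B : 'M[C]_n.+1) (s : seq C) :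
  foldl (fun B z => (M - z%:M) *m B) B s =
  horner_mx M (\prod_(z <- s) ('X - z%:P)) *m B.
Proof.
elim: s B => [|z s IH] B /=; first by rewrite big_nil rmorph1 mul1mx.
rewrite IH big_cons mulrC rmorphM /= mulmxA; congr (_ *m _ *m _).
by rewrite rmorphB /= horner_mx_X horner_mx_C.
Qed.

(** Peel off one factor at a time: the powers of [M] applied to [B] satisfy the
first-order recursion with ratio [z] whose forcing term, coming from
[(M - z) B], is already under control. *)
Lemma mx_annihilated_growth n (M B : 'M[C]_n) (s : seq C) (r : R) :
  (forall z, z \in s -> normc z < r) ->
  foldl (fun B z => (M - z%:M) *m B) B s = 0 ->
  exists2 D, 0 <= D & forall m i j, normc ((M ^+ m *m B) i j) <= D * r ^+ m.
Proof.
elim: s B => [|z s IH] B /= sr.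
  by move=> ->; exists 0 => // m i j; rewrite mulmx0 mxE normc0 mul0r.
move=> /IH[y ys|D D0 hD]; first by rewrite sr // inE ys orbT.
have zr := sr z (mem_head _ _).
have hij i j : exists2 E, 0 <= E & forall m, normc ((M ^+ m *m B) i j) <= E * r ^+ m.
  apply: (geometric_recursion (normc_ge0 z) zr D0) => m.
  have -> : M ^+ m.+1 *m B = z *: (M ^+ m *m B) + M ^+ m *m ((M - z%:M) *m B).
    rewrite exprSr mulmxBl mulmxBr mul_scalar_mx -scalemxAr addrCA subrr addr0.
    by rewrite mulmxA.
  rewrite mxE; apply: le_trans (normc_triangle _ _) _.
  by rewrite mxE normcM lerD2l hD.
have [E hE] := choice (fun p : 'I_n * 'I_n =>
  let: ex_intro2 E E0 h := hij p.1 p.2 in ex_intro (fun E => 0 <= E /\ _) E (conj E0 h)).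
exists (\sum_p E p); first by apply: sumr_ge0 => p _; case: (hE p).
move=> m i j; have [_ /(_ m)/= h] := hE (i, j).
apply: le_trans h _; rewrite ler_wpM2r ?exprn_ge0 //.
  by rewrite ltW // (le_lt_trans (normc_ge0 z)).
rewrite (bigD1 (i, j)) //= lerDl.
by apply: sumr_ge0 => p _; case: (hE p).
Qed.

(** By Cayley-Hamilton the roots of the characteristic polynomial annihilate
[M], so [mx_annihilated_growth] applies to the identity matrix. *)
Lemma mx_power_growth n (M : 'M[C]_n) r : mx_spectral_radius M < r ->
  exists2 D, 0 <= D & forall m i j, normc ((M ^+ m) i j) <= D * r ^+ m.
Proof.
case: n M => [|n] M Mr; first by exists 0 => // m [].
have [s e] := char_poly_roots M.
have [||D D0 hD] := @mx_annihilated_growth _ M 1%:M s r.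
- move=> z zs; apply: le_lt_trans Mr; have [h _] := mx_spectral_radiusP M.
  by apply: h; rewrite eigenvalue_root_char e root_prod_XsubC.
- by rewrite horner_mx_prod -e Cayley_Hamilton mul0mx.
by exists D => // m i j; rewrite -[M ^+ m]mulmx1; exact: hD.
Qed.

End MatrixSpectralRadius.

(** * Words in the matrices *)

Section Words.
Variable g : nat.

Fixpoint words n : seq (seq 'I_g) :=
  if n is n'.+1 then [seq j :: w | j <- enum 'I_g, w <- words n'] else [:: [::]].

Lemma big_words (V : nmodType) n (F : seq 'I_g -> V) :
  \sum_(w <- words n.+1) F w = \sum_j \sum_(w <- words n) F (j :: w).
Proof. by rewrite /= big_allpairs_dep big_enum. Qed.

Lemma mem_words n w : (w \in words n) = (size w == n).
Proof.
elim: n w => [|n IH] [|j w] //=; first by apply/allpairsP => -[] [? ?] [].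
apply/allpairsP/idP => [[[i v] /= [_ vn [_ ->]]]|wn].
  by move: vn; rewrite IH eqSS.
by exists (j, w); rewrite /= mem_enum IH -eqSS.
Qed.

Lemma uniq_words n : uniq (words n).
Proof.
elim: n => //= n IH; apply: allpairs_uniq => //; first exact: enum_uniq.
by move=> [i v] [j w] _ _ [-> ->].
Qed.

(** Ordered so that a sum over [words_lt N] is a sum over the lengths
[n < N] of sums over [words n]. *)
Fixpoint words_lt N : seq (seq 'I_g) :=
  if N is n.+1 then words_lt n ++ words n else [::].

Lemma words_lt_size N w : w \in words_lt N -> (size w < N)%N.
Proof.
elim: N => //= N IH; rewrite mem_cat => /orP[/IH/ltnW //|].
by rewrite mem_words => /eqP ->.
Qed.

Lemma uniq_words_lt N : uniq (words_lt N).
Proof.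
elim: N => //= N IH; rewrite cat_uniq IH uniq_words andbT /=.
apply/hasPn => w; rewrite mem_words => /eqP wN.
by apply/negP => /words_lt_size; rewrite wN ltnn.
Qed.

End Words.

Section MatrixWords.
Variables (R : realType) (g k : nat) (X : 'I_g -> 'M[R[i]]_k).
Local Notation C := R[i].

Definition energy n (a : seq 'I_g -> C) : R :=
  \sum_(w <- words g n) normc (a w) ^+ 2.

Lemma energy_ge0 n a : 0 <= energy n a.
Proof. by apply: sumr_ge0 => w _; exact: sqr_ge0. Qed.

Definition mx_word (w : seq 'I_g) : 'M[C]_k := foldr (fun j Y => X j *m Y) 1%:M w.

Definition coef i j (w : seq 'I_g) : C := mx_word w i j.

(** The matrix of the completely positive map [Y |-> \sum_j X_j Y X_j^*]. *)
Definition kraus_mx : 'M[C]_(k * k) := \sum_(j < g) X j *t map_mx conjc (X j).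

(** The tensor product is multiplicative, so each choice of indices in the
expanded power contributes the same word in both factors. *)
Lemma kraus_mx_expr n :
  kraus_mx ^+ n = \sum_(w <- words g n) mx_word w *t map_mx conjc (mx_word w).
Proof.
elim: n => [|n IH].
  rewrite big_seq1 expr0 map_mx1; apply/matrixP => p q.
  rewrite -[p]mxtens_unindexK -[q]mxtens_unindexK.
  case: (mxtens_unindex p) (mxtens_unindex q) => [i i'] [j j'].
  rewrite tensmxE !mxE (can_eq (@mxtens_indexK k k)) xpair_eqE.
  by rewrite -natrM mulnb.
rewrite exprS IH big_words mulr_suml; apply: eq_bigr => j _.
rewrite mulr_sumr; apply: eq_bigr => w _.
by rewrite /= map_mxM -tensmx_mul.
Qed.

Lemma kraus_mx_exprE n i i' j j' :
  (kraus_mx ^+ n) (mxtens_index (i, i')) (mxtens_index (j, j')) =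
  \sum_(w <- words g n) coef i j w * conjc (coef i' j' w).
Proof.
by rewrite kraus_mx_expr summxE; apply: eq_bigr => w _; rewrite tensmxE !mxE.
Qed.

Lemma energy_kraus n i j :
  (energy n (coef i j))%:C%C =
  (kraus_mx ^+ n) (mxtens_index (i, i)) (mxtens_index (j, j)).
Proof.
by rewrite kraus_mx_exprE rmorph_sum; apply: eq_bigr => w _; rewrite mulr_conjc.
Qed.

Lemma kraus_mx_entry_le n i i' j j' :
  normc ((kraus_mx ^+ n) (mxtens_index (i, i')) (mxtens_index (j, j'))) ^+ 2 <=
  energy n (coef i j) * energy n (coef i' j').
Proof.
rewrite kraus_mx_exprE; apply: le_trans (cauchy_schwarz_normc _ _ _) _.
by under [X in _ * X <= _]eq_bigr do rewrite normc_conjc.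
Qed.

Lemma energy_growth r : mx_spectral_radius kraus_mx < r ->
  exists2 D, 0 <= D & forall n i j, energy n (coef i j) <= D * r ^+ n.
Proof.
move=> /mx_power_growth[D D0 hD]; exists D => // n i j.
apply: le_trans (hD n (mxtens_index (i, i)) (mxtens_index (j, j))).
by rewrite -energy_kraus normc_real ger0_norm ?energy_ge0.
Qed.

Definition total_energy n : R := \sum_i \sum_j energy n (coef i j).

Lemma energy_le_total n i j : energy n (coef i j) <= total_energy n.
Proof.
rewrite /total_energy (bigD1 i) //= (bigD1 j) //= -addrA lerDl addr_ge0 //.
  by apply: sumr_ge0 => *; exact: energy_ge0.
by apply: sumr_ge0 => *; apply: sumr_ge0 => *; exact: energy_ge0.
Qed.

(** By Cauchy-Schwarz the total energy dominates every entry of the power of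
[kraus_mx], while a left eigenvector for an eigenvalue of maximal modulus shows
that those entries cannot be small simultaneously. *)
Lemma total_energy_ge : (0 < k)%N -> exists2 e, 0 < e &
  forall n, e * mx_spectral_radius kraus_mx ^+ n <= total_energy n.
Proof.
move=> k0; have [_] := mx_spectral_radiusP kraus_mx.
case=> [|z /eigenvalueP[v vz v0] <-]; first by rewrite muln_gt0 k0.
have /rV0Pn[q vq] := v0.
have vq0 : 0 < normc (v 0 q).
  by rewrite lt_neqAle normc_ge0 andbT eq_sym; apply: contra_neq vq => /eq0_normc.
pose S := \sum_p normc (v 0 p).
have vS : normc (v 0 q) <= S.
  by rewrite /S (bigD1 q) //= lerDl sumr_ge0 // => p _; exact: normc_ge0.
have S0 : 0 < S := lt_le_trans vq0 vS.
exists (normc (v 0 q) / S); first exact: divr_gt0.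
move=> n; rewrite mulrAC ler_pdivrMr //.
have -> : normc (v 0 q) * normc z ^+ n = normc ((v *m kraus_mx ^+ n) 0 q).
  have -> : v *m kraus_mx ^+ n = z ^+ n *: v.
    elim: n => [|n IH]; first by rewrite expr0 mulmx1 scale1r.
    by rewrite exprSr mulmxA IH -scalemxAl vz scalerA -exprSr.
  by rewrite mxE normcM normcX mulrC.
rewrite mxE; apply: le_trans (normc_sum_le _ _) _.
rewrite mulr_sumr; apply: ler_sum => p _; rewrite normcM mulrC.
rewrite ler_wpM2r ?normc_ge0 //.
rewrite -[p]mxtens_unindexK -[q]mxtens_unindexK.
case: (mxtens_unindex p) (mxtens_unindex q) => [i i'] [j j'].
have E0 : 0 <= total_energy n := le_trans (energy_ge0 n _) (energy_le_total n i j).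
rewrite -ler_sqr ?nnegrE ?normc_ge0 //.
apply: le_trans (kraus_mx_entry_le _ _ _ _ _) _.
by rewrite expr2 ler_pM ?energy_ge0 ?energy_le_total.
Qed.

End MatrixWords.

(** * Cancellation against positive words *)

Section PositiveWords.
Variable g : nat.
Local Notation G := (free_group g).

Definition positive (w : seq 'I_g) : G := foldr (fun j x => free_gen j * x)%g 1%g w.

Lemma word_positive w : word (positive w) = [seq (j, false) | j <- w].
Proof.
elim: w => //= j w IH; rewrite IH.
by case: w {IH} => //= i w; rewrite /linv /= xpair_eqE andbF.
Qed.

Lemma positive_inj : injective positive.
Proof.
move=> v w /(congr1 (fun x : G => map fst (word x))).
by rewrite !word_positive -!map_comp !map_id.
Qed.

Lemma reduce_cat_reduced (v w : seq (letter g)) :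
  reduced (v ++ w) -> reduce_cat v w = v ++ w.
Proof.
elim: v => //= a v IH r; rewrite IH ?cons_letterE //.
exact: reduced_behead r.
Qed.

(** The product [(positive w)^-1 * y] has cancellation exactly when its left
factor, which ends with the inverse of the first letter of [w], meets that same
letter at the head of [y]. *)
Definition cancels (w : seq 'I_g) (y : G) : bool :=
  if w is j :: _ then ohead (word y) == Some (j, false) else false.

(** Cancellation in the product can only start at the junction of the two
words, and there it is excluded. *)
Lemma word_invM_positive j w (y : G) : ~~ cancels (j :: w) y ->
  word ((positive (j :: w))^-1 * y)%g =
  winv [seq (i, false) | i <- j :: w] ++ word y.
Proof.
move=> ncy; rewrite -word_positive.
apply: (@reduce_cat_reduced (winv (word (positive (j :: w))))).
have rw := reduced_winv (word_reduced (positive (j :: w))).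
move: rw; rewrite word_positive /winv [map _ (j :: w)]map_cons map_cons rev_cons.
move: (rev _) => v; have := word_reduced y; move: ncy; rewrite /cancels.
case: (word y) => [|b s]; first by rewrite cats0.
rewrite /= -[Some b == _]/(b == (j, false)) => bj rb rv.
rewrite /reduced cat_rcons; case: v rv => [|a v] rv /=.
  by rewrite /linv /= bj.
by move: rv; rewrite /reduced /= rcons_path cat_path /= => /andP[-> ->]; rewrite /linv /= bj.
Qed.

(** Recovers [w] from an [x] whose word starts with the inverse of [positive w]. *)
Definition prefix_decode n (x : G) : seq 'I_g := rev (map fst (take n (word x))).

Lemma not_cancels_decode n w (x : G) : w \in words g n.+1 ->
  ~~ cancels w (positive w * x)%g -> w = prefix_decode n.+1 x.
Proof.
rewrite mem_words; case: w => // j w /eqP <- nc.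
rewrite /prefix_decode -[x in word x](mulKg (positive (j :: w))).
rewrite word_invM_positive // take_size_cat; last by rewrite size_rev !size_map.
by rewrite /winv map_rev revK -!map_comp map_id.
Qed.

(** A product [(positive w)^-1 * y] without cancellation remembers [w], whose
length is known.  In the Haagerup inequality this makes the non-cancelling
parts for different [w] read off disjoint portions of the vector. *)
Lemma sum_not_cancels_le1 (R : realType) n (x : G) :
  \sum_(w <- words g n.+1) (~~ cancels w (positive w * x)%g)%:R <= 1 :> R.
Proof.
apply: (@le_trans _ _ (\sum_(w <- words g n.+1) (w == prefix_decode n.+1 x)%:R)).
  rewrite big_seq [leRHS]big_seq; apply: ler_sum => w wn.
  by case: (boolP (cancels _ _)) => //= nc; rewrite [X in X == _](not_cancels_decode wn nc) eqxx.
rewrite -natr_sum -[X in _ <= X]/(1%:R) ler_nat.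
apply: leq_trans (leq_b1 (prefix_decode n.+1 x \in words g n.+1)).
rewrite -(count_uniq_mem _ (uniq_words g n.+1)) -sum1_count [leqRHS]big_mkcond.
by apply: leq_sum => w _ /=; case: eqP.
Qed.

End PositiveWords.

(** * A Haagerup inequality for positive words *)

Section Haagerup.
Variables (R : realType) (g : nat).
Local Notation C := R[i].
Local Notation G := (free_group g).

Lemma esumZ_le (T : choiceType) (c : R) (u : T -> \bar R) :
  0 <= c -> (forall x, 0 <= u x)%E ->
  (\esum_(x in [set: T]) (c%:E * u x) <= c%:E * \esum_(x in [set: T]) u x)%E.
Proof.
move=> c0 u0; apply: ge_ereal_sup => _ [A fA <-].
rewrite -ge0_mule_fsumr //; apply: lee_wpmul2l; first by rewrite lee_fin.
by apply: ereal_sup_ubound; exists A.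
Qed.

Lemma esum_translate (x : G) (u : G -> \bar R) :
  (\esum_(y in [set: G]) u y = \esum_(y in [set: G]) u (x * y)%g)%E.
Proof.
rewrite [LHS](@reindex_esum R G G setT setT (fun y => x * y)%g) //.
split=> //; first by move=> a b _ _ /mulgI.
by move=> y _; exists (x^-1 * y)%g => //; rewrite mulVKg.
Qed.

(** The action of [\sum_w a w *: lambda (positive w)] on arbitrary functions. *)
Definition convol n (a : seq 'I_g -> C) (f : G -> C) (y : G) : C :=
  \sum_(w <- words g n) a w * f ((positive w)^-1 * y)%g.

Lemma convolS n a f y :
  convol n.+1 a f y =
  \sum_j convol n (fun w => a (j :: w)) f ((free_gen j)^-1 * y)%g.
Proof.
rewrite /convol big_words; apply: eq_bigr => j _; apply: eq_bigr => w _.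
by rewrite /= invgM mulgA.
Qed.

Lemma energyS n (a : seq 'I_g -> C) :
  energy n.+1 a = \sum_j energy n (fun w => a (j :: w)).
Proof. by rewrite /energy big_words. Qed.

(** The term [z] collects the indices [j] for which [y] starts with the
generator [j]: at most one exists, so the square of a sum is bounded by a sum
of squares.  For the other indices nothing cancels in the product. *)
Lemma convolS_split n a f y :
  exists2 z : C, normc z ^+ 2 <=
     \sum_j normc (convol n (fun w => a (j :: w)) f ((free_gen j)^-1 * y)%g) ^+ 2 &
  convol n.+1 a f y = z + \sum_(w <- words g n.+1)
     a w * ((~~ cancels w y)%:R * f ((positive w)^-1 * y)%g).
Proof.
pose F j := convol n (fun w => a (j :: w)) f ((free_gen j)^-1 * y)%g.
pose st j := ohead (word y) == Some (j, false).
exists (\sum_(j | st j) F j).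
  have [j stj|nst] := pickP st.
    rewrite (big_pred1 j) => [|i]; last first.
      apply/idP/eqP => [sti|-> //]; move: (eqP sti); rewrite (eqP stj).
      by case.
    rewrite (bigD1 j) //= lerDl; apply: sumr_ge0 => *; exact: sqr_ge0.
  rewrite big_pred0 // normc0 expr0n.
  by apply: sumr_ge0 => *; exact: sqr_ge0.
rewrite convolS big_words (bigID st) /= -/F.
have h j : \sum_(w <- words g n) a (j :: w) *
   ((~~ st j)%:R * f ((free_gen j * positive w)^-1 * y)%g) = if st j then 0 else F j.
  rewrite /F /convol; case: (st j) => /=.
    by rewrite big1 // => w _; rewrite mul0r mulr0.
  by apply: eq_bigr => w _; rewrite mul1r invgM mulgA.
under [X in _ + X = _]eq_bigr => j nst do rewrite -/(F j).
congr (_ + _); rewrite big_mkcond; apply: eq_bigr => j _; rewrite h.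
by case: (st j).
Qed.

(** Induction on the length.  In [convolS_split], the first part is controlled
by the inductive hypothesis; for the second, pointwise Cauchy-Schwarz costs the
energy of [a] and leaves a sum over the non-cancelling words, at most
[sqsum f] by [sum_not_cancels_le1].  The weight [t = n + 1] in
[normc_sqrD_weighted] adds the bounds [n + 1] and 1 on the norms of the two
parts to exactly [n + 2]. *)
Lemma haagerup_convol n a (f : ell2 R G) :
  (sqsum (convol n a f) <= (n.+1%:R ^+ 2 * energy n a)%:E * sqsum f)%E.
Proof.
elim: n a => [|n IH] a.
  rewrite expr1n mul1r /energy big_seq1.
  apply: le_trans (sqsumZ (a [::]) f); rewrite le_eqVlt; apply/orP; left.
  apply/eqP; congr sqsum; apply/funext => y.
  by rewrite /convol big_seq1 /= invg1 mul1g.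
pose t : R := n.+1%:R; have t0 : 0 < t by rewrite ltr0n.
have tS : n.+2%:R = t + 1 by rewrite /t natr1.
rewrite tS.
pose F j y := normc (convol n (fun w => a (j :: w)) f ((free_gen j)^-1 * y)%g) ^+ 2.
pose H w y := (~~ cancels w y)%:R * normc (f ((positive w)^-1 * y)%g) ^+ 2.
have H0 w y : 0 <= H w y by rewrite mulr_ge0 ?ler0n ?sqr_ge0.
have F0 j y : 0 <= F j y by exact: sqr_ge0.
have step y : normc (convol n.+1 a f y) ^+ 2 <=
    (t + 1) / t * (\sum_j F j y) +
    (t + 1) * energy n.+1 a * (\sum_(w <- words g n.+1) H w y).
  have [z zle ->] := convolS_split n a f y.
  apply: le_trans (normc_sqrD_weighted _ _ t0) _; apply: lerD.
    by rewrite ler_pM2l ?divr_gt0 ?addr_gt0.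
  rewrite -mulrA ler_pM2l ?addr_gt0 //.
  apply: le_trans (cauchy_schwarz_normc _ _ _) _.
  rewrite ler_wpM2l ?energy_ge0 //; apply: ler_sum => w _.
  rewrite /H; case: (cancels w y) => /=; last by rewrite !mul1r.
  by rewrite !mul0r normc0 expr0n.
have [s s0 sE] : exists2 s : R, 0 <= s & sqsum f = s%:E.
  exists (fine (sqsum f)); last by rewrite fineK ?sqsum_fin.
  by rewrite fine_ge0 ?sqsum_ge0.
have sumF : (\esum_(y in [set: G]) (\sum_j F j y)%:E <=
    (t ^+ 2 * energy n.+1 a)%:E * sqsum f)%E.
  under eq_esum do rewrite -sumEFin.
  rewrite esum_sum; last by move=> *; rewrite lee_fin F0.
  apply: (@le_trans _ _ (\sum_j (t ^+ 2 * energy n (fun w => a (j :: w)))%:E * sqsum f)%E).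
    apply: lee_sum => j _; rewrite (esum_translate (free_gen j)).
    apply: le_trans (IH _); rewrite le_eqVlt; apply/orP; left; apply/eqP.
    by apply: eq_esum => y _; rewrite /F mulKg.
  rewrite sE; under eq_bigr do rewrite -EFinM.
  by rewrite sumEFin -EFinM lee_fin -mulr_suml -mulr_sumr energyS.
have sumH : (\esum_(y in [set: G]) (\sum_(w <- words g n.+1) H w y)%:E <= sqsum f)%E.
  under eq_esum do rewrite -sumEFin.
  rewrite esum_sum; last by move=> *; rewrite lee_fin H0.
  under eq_bigr => w _ do rewrite (esum_translate (positive w)).
  rewrite -esum_sum; last by move=> *; rewrite lee_fin H0.
  apply: le_esum => y _; rewrite sumEFin lee_fin /H.
  under eq_bigr do rewrite mulKg.
  by rewrite -mulr_suml ler_piMl ?sqr_ge0 ?sum_not_cancels_le1.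
have c1 : 0 <= (t + 1) / t by rewrite divr_ge0 ?addr_ge0 // ltW.
have c2 : 0 <= (t + 1) * energy n.+1 a by rewrite mulr_ge0 ?energy_ge0 ?addr_ge0 // ltW.
have P1 y : (0 <= (\sum_j F j y)%:E)%E by rewrite lee_fin sumr_ge0.
have P2 y : (0 <= (\sum_(w <- words g n.+1) H w y)%:E)%E by rewrite lee_fin sumr_ge0.
apply: (@le_trans _ _ (((t + 1) / t)%:E * ((t ^+ 2 * energy n.+1 a)%:E * sqsum f) +
   ((t + 1) * energy n.+1 a)%:E * sqsum f)%E).
  apply: (@le_trans _ _ (\esum_(y in [set: G])
    (((t + 1) / t)%:E * (\sum_j F j y)%:E +
     ((t + 1) * energy n.+1 a)%:E * (\sum_(w <- words g n.+1) H w y)%:E))%E).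
    by apply: le_esum => y _; rewrite -!EFinM -EFinD lee_fin step.
  rewrite esumD; [|by move=> y _; rewrite mule_ge0..].
  apply: leeD.
    apply: le_trans (esumZ_le c1 P1) _.
    by rewrite lee_wpmul2l ?lee_fin.
  apply: le_trans (esumZ_le c2 P2) _.
  by rewrite lee_wpmul2l ?lee_fin.
rewrite sE -!EFinM -EFinD lee_fin le_eqVlt; apply/orP; left; apply/eqP.
by field; rewrite gt_eqF.
Qed.

End Haagerup.

(** * Geometric convergence in the Hilbert space *)

Section GeometricSequences.
Variables (R : realType) (q : R).
Hypotheses (q0 : 0 < q) (q1 : q < 1).
Local Notation C := R[i].

Lemma le_add_geometric (x a D : R) : (forall n, x <= a + D * q ^+ n) -> x <= a.
Proof.
move=> h; apply/ler_addgt0Pr => e e0.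
have [|n hn] := @unbounded_expr _ q^-1 (`|D| / e); first by rewrite invf_gt1.
apply: le_trans (h n) _; rewrite lerD2l.
move: hn; rewrite exprVn ltr_pdivrMr // mulrC ltr_pdivlMr ?exprn_gt0 // => hn.
apply: le_trans (ltW hn); rewrite ler_wpM2r ?ler_norm //.
by rewrite exprn_ge0 // ltW.
Qed.

(** The sequences [u n - E * q ^+ n] and [u n + E * q ^+ n] are respectively
nondecreasing and nonincreasing, so that the supremum of the former is the
limit. *)
Lemma real_geometric_cvg (u : nat -> R) (D : R) : 0 <= D ->
  (forall n, `|u n.+1 - u n| <= D * q ^+ n) ->
  exists l, forall n, `|l - u n| <= D / (1 - q) * q ^+ n.
Proof.
move=> D0 hu; set E := D / (1 - q).
have q1' : 0 < 1 - q by rewrite subr_gt0.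
have DE : D = E * (1 - q) by rewrite divfK ?gt_eqF.
have lo n : u n - E * q ^+ n <= u n.+1 - E * q ^+ n.+1.
  by have := hu n; rewrite ler_norml DE exprS => /andP[h _]; lra.
have hi n : u n.+1 + E * q ^+ n.+1 <= u n + E * q ^+ n.
  by have := hu n; rewrite ler_norml DE exprS => /andP[_ h]; lra.
have loD n m : u n - E * q ^+ n <= u (n + m)%N - E * q ^+ (n + m).
  elim: m => [|m IH]; first by rewrite addn0.
  by rewrite addnS; exact: le_trans IH (lo _).
have hiD n m : u (n + m)%N + E * q ^+ (n + m) <= u n + E * q ^+ n.
  elim: m => [|m IH]; first by rewrite addn0.
  by rewrite addnS; exact: le_trans (hi _) IH.
have lohi n m : u n - E * q ^+ n <= u m + E * q ^+ m.
  apply: le_trans (loD n m) _; rewrite addnC; apply: le_trans (hiD m n).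
  have : 0 <= E * q ^+ (m + n) by rewrite mulr_ge0 ?divr_ge0 ?exprn_ge0 // ltW.
  lra.
pose A := [set u n - E * q ^+ n | n in [set: nat]].
have A0 : A (u 0%N - E * q ^+ 0) by exists 0%N.
have Aub m : ubound A (u m + E * q ^+ m) by move=> x [n _ <-].
exists (sup A) => n.
have h1 : sup A <= u n + E * q ^+ n by apply: ge_sup => //; exists (u 0%N - E * q ^+ 0).
have h2 : u n - E * q ^+ n <= sup A.
  by apply: ub_le_sup; [exists (u 0%N + E * q ^+ 0); exact: Aub|exists n].
by rewrite ler_norml; lra.
Qed.

Lemma complex_geometric_cvg (u : nat -> C) (D : R) : 0 <= D ->
  (forall n, normc (u n.+1 - u n) <= D * q ^+ n) ->
  exists l, forall n, normc (l - u n) <= 2 * (D / (1 - q)) * q ^+ n.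
Proof.
move=> D0 hu.
have [|x hx] := @real_geometric_cvg (fun n => complex.Re (u n)) D D0.
  by move=> n; apply: le_trans (hu n); rewrite -raddfB normRe_le.
have [|y hy] := @real_geometric_cvg (fun n => complex.Im (u n)) D D0.
  by move=> n; apply: le_trans (hu n); rewrite -raddfB normIm_le.
exists (x +i* y)%C => n; apply: le_trans (normc_le_ReIm _) _.
rewrite !raddfB /= -mulrA mulr_natl mulr2n; exact: lerD.
Qed.

End GeometricSequences.

Section HilbertSpace.
Variables (R : realType) (G : groupType).
Local Notation C := R[i].
Local Notation H := (ell2 R G).
Implicit Types f : H.

Lemma sqsum_le_seq (h : G -> C) (B : R) :
  (forall s : seq G, uniq s -> \sum_(y <- s) normc (h y) ^+ 2 <= B) ->
  (sqsum h <= B%:E)%E.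
Proof.
move=> hB; apply: ge_ereal_sup => _ [A [finA _] <-].
by rewrite fsbig_finite //= sumEFin lee_fin; apply: hB; exact: fset_uniq.
Qed.

Lemma sqsum_ge_seq (h : G -> C) (s : seq G) : uniq s ->
  ((\sum_(y <- s) normc (h y) ^+ 2)%:E <= sqsum h)%E.
Proof.
move=> us; apply: esum_ge; exists [set` s]; first by split=> //; exact: finite_seq.
by rewrite -sumEFin -fsbig_seq.
Qed.

Lemma sqsumD_weighted (t : R) (f1 f2 : G -> C) : 0 < t ->
  (sqsum (f1 + f2)%R <= ((t + 1) / t)%:E * sqsum f1 + (t + 1)%:E * sqsum f2)%E.
Proof.
move=> t0; have c1 : 0 <= (t + 1) / t by rewrite divr_ge0 ?addr_ge0 // ltW.
have c2 : 0 <= t + 1 by rewrite addr_ge0 // ltW.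
have P (f : G -> C) x : (0 <= (normc (f x) ^+ 2)%:E)%E by rewrite lee_fin sqr_ge0.
apply: (@le_trans _ _ (\esum_(x in [set: G]) (((t + 1) / t)%:E * (normc (f1 x) ^+ 2)%:E +
   (t + 1)%:E * (normc (f2 x) ^+ 2)%:E))%E).
  by apply: le_esum => x _; rewrite -!EFinM -EFinD lee_fin normc_sqrD_weighted.
rewrite esumD; [|by move=> x _; rewrite mule_ge0 ?lee_fin ?sqr_ge0..].
by apply: leeD; exact: esumZ_le.
Qed.

Lemma sqsum_l2norm f : sqsum f = (l2norm f ^+ 2)%:E.
Proof. by rewrite sqr_l2norm fineK ?sqsum_fin. Qed.

Lemma l2norm_le f (x : R) : 0 <= x -> (sqsum f <= (x ^+ 2)%:E)%E -> l2norm f <= x.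
Proof.
by move=> x0; rewrite sqsum_l2norm lee_fin ler_sqr ?nnegrE ?l2norm_ge0.
Qed.

(** Take [t] to be the ratio of the two norms in [sqsumD_weighted]; both are
first increased by [e / 2] so that the ratio makes sense. *)
Lemma l2norm_triangle f1 f2 : l2norm (f1 + f2) <= l2norm f1 + l2norm f2.
Proof.
set a := l2norm f1; set b := l2norm f2.
have a0 : 0 <= a := l2norm_ge0 _; have b0 : 0 <= b := l2norm_ge0 _.
apply/ler_addgt0Pr => e e0.
pose a' := a + e / 2; pose b' := b + e / 2.
have a'0 : 0 < a' by rewrite /a'; lra.
have b'0 : 0 < b' by rewrite /b'; lra.
have -> : a + b + e = a' + b' by rewrite /a' /b'; lra.
apply: l2norm_le; first by rewrite addr_ge0 // ltW.
apply: le_trans (sqsumD_weighted f1 f2 (divr_gt0 a'0 b'0)) _.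
rewrite !sqsum_l2norm -/a -/b -!EFinM -EFinD lee_fin.
apply: (@le_trans _ _ ((a' / b' + 1) / (a' / b') * a' ^+ 2 + (a' / b' + 1) * b' ^+ 2)).
  have aa : a ^+ 2 <= a' ^+ 2 by rewrite ler_sqr ?nnegrE ?(ltW a'0) // /a'; lra.
  have bb : b ^+ 2 <= b' ^+ 2 by rewrite ler_sqr ?nnegrE ?(ltW b'0) // /b'; lra.
  have t0 : 0 <= a' / b' by rewrite divr_ge0 // ltW.
  have t1 : 0 <= a' / b' + 1 by rewrite addr_ge0.
  by apply: lerD; apply: ler_wpM2l => //; exact: divr_ge0.
rewrite le_eqVlt; apply/orP; left; apply/eqP.
by field; rewrite !gt_eqF.
Qed.

Lemma l2normN f : l2norm (- f) = l2norm f.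
Proof.
have h f' : l2norm (- f') <= l2norm f'.
  rewrite -scaleN1r; apply: le_trans (l2normZ_le _ _) _.
  by rewrite normc_opp normc1 mul1r.
by apply/eqP; rewrite eq_le h -{1}[f]opprK h.
Qed.

Lemma l2norm_sum (I : Type) (s : seq I) (F : I -> H) :
  l2norm (\sum_(i <- s) F i) <= \sum_(i <- s) l2norm (F i).
Proof.
elim: s => [|i s IH]; first by rewrite !big_nil l2norm0.
by rewrite !big_cons; apply: le_trans (l2norm_triangle _ _) _; rewrite lerD2l.
Qed.

Lemma normc_le_l2norm f y : normc (f y) <= l2norm f.
Proof.
rewrite -ler_sqr ?nnegrE ?normc_ge0 ?l2norm_ge0 // -lee_fin -sqsum_l2norm.
apply: esum_ge; exists [set y]; first by split=> //; exact: finite_set1.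
by rewrite fsbig_set1.
Qed.

Lemma l2norm_eq0 f : l2norm f <= 0 -> f = 0.
Proof.
move=> f0; apply: val_inj; apply/funext => y; apply: eq0_normc.
by apply/eqP; rewrite eq_le normc_ge0 andbT (le_trans (normc_le_l2norm f y)).
Qed.

(** The limit is taken pointwise.  On a finite set of points it inherits the
bound for [f (n + j) - f n] up to an error vanishing with [j], which bounds the
sum of squares over the whole group. *)
Lemma ell2_geometric_cvg (q D : R) (f : nat -> H) : 0 < q -> q < 1 -> 0 <= D ->
  (forall n, l2norm (f n.+1 - f n) <= D * q ^+ n) ->
  exists F : H, forall n, l2norm (F - f n) <= 2 * (D / (1 - q)) * q ^+ n.
Proof.
move=> q0 q1 D0 hf; set E := D / (1 - q).
have q1' : 0 < 1 - q by rewrite subr_gt0.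
have E0 : 0 <= E by rewrite divr_ge0 // ltW.
have DE : D = E * (1 - q) by rewrite divfK ?gt_eqF.
have tail n m : l2norm (f (n + m)%N - f n) <= E * q ^+ n.
  suff : l2norm (f (n + m)%N - f n) <= E * q ^+ n - E * q ^+ (n + m).
    move=> h; apply: le_trans h _; rewrite gerBl mulr_ge0 // exprn_ge0 //.
    exact: ltW.
  elim: m => [|m IH]; first by rewrite addn0 !subrr l2norm0.
  rewrite addnS -(subrK (f (n + m)%N) (f _)) -addrA.
  apply: le_trans (l2norm_triangle _ _) _.
  apply: le_trans (lerD (hf _) IH) _; rewrite exprS DE; lra.
have [h hh] := choice (fun y => complex_geometric_cvg q0 q1 D0
  (fun n => le_trans (normc_le_l2norm (f n.+1 - f n) y) (hf n))).
have Eq0 n : 0 <= 2 * E * q ^+ n.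
  by apply: mulr_ge0; [exact: mulr_ge0|rewrite exprn_ge0 // ltW].
have key n : (sqsum (fun y => h y - f n y)%R <= ((2 * E * q ^+ n) ^+ 2)%:E)%E.
  apply: sqsum_le_seq => s us.
  apply: (@le_trans _ _ (2 * (E * q ^+ n) ^+ 2)); last first.
    by rewrite -mulrA [leRHS]exprMn ler_wpM2r ?sqr_ge0 //; lra.
  apply: (@le_add_geometric R q q0 q1 _ _ (\sum_(y <- s) 2 * (2 * E) ^+ 2)) => j.
  have fin : \sum_(y <- s) normc ((f (n + j)%N - f n) y) ^+ 2 <= (E * q ^+ n) ^+ 2.
    rewrite -lee_fin; apply: le_trans (sqsum_ge_seq _ us) _.
    rewrite sqsum_l2norm lee_fin ler_sqr ?nnegrE ?l2norm_ge0 ?tail //.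
    by rewrite mulr_ge0 ?exprn_ge0 // ltW.
  have qj : (q ^+ (n + j)) ^+ 2 <= q ^+ j.
    by rewrite -exprM ler_wiXn2l // ?ltW //; lia.
  apply: (@le_trans _ _ (\sum_(y <- s) (2 * normc ((f (n + j)%N - f n) y) ^+ 2
     + 2 * (2 * E) ^+ 2 * q ^+ j))); last first.
    by rewrite big_split /= -mulr_sumr -mulr_suml lerD2r ler_wpM2l.
  apply: ler_sum => y _.
  have -> : h y - f n y = (f (n + j)%N y - f n y) + (h y - f (n + j)%N y) by ring.
  apply: le_trans (normc_sqrD_weighted _ _ (ltr01 : 0 < 1 :> R)) _.
  rewrite divr1; apply: lerD => //; rewrite -mulrA ler_wpM2l //.
  have hE : normc (h y - f (n + j)%N y) ^+ 2 <= (2 * E * q ^+ (n + j)) ^+ 2.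
    by rewrite ler_sqr ?nnegrE ?normc_ge0 ?hh.
  by apply: le_trans hE _; rewrite exprMn ler_wpM2l ?sqr_ge0.
have ss0 : square_summable (fun y => h y - f 0%N y).
  by apply: le_lt_trans (key 0%N) _; rewrite ltry.
exists (Ell2 ss0 + f 0%N) => n.
apply: l2norm_le; first exact: Eq0.
apply: le_trans (key n); rewrite le_eqVlt; apply/orP; left; apply/eqP.
congr sqsum; apply/funext => y.
by rewrite -[LHS]/(h y - f 0%N y + f 0%N y - f n y) subrK.
Qed.

End HilbertSpace.

(** * Geometric convergence of operators and the Neumann series *)

Section Operators.
Variables (R : realType) (G : groupType) (q : R).
Hypotheses (q0 : 0 < q) (q1 : q < 1).
Local Notation C := R[i].
Local Notation op := (bounded_op R G).
Local Notation A := (cstar_red R G).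
Implicit Types S T : op.

Definition geometric (U : nat -> op) : Prop :=
  exists2 D, 0 <= D & forall n, bounded_by (D * q ^+ n) (U n).

Lemma geometricD U V : geometric U -> geometric V -> geometric (fun n => U n + V n).
Proof.
move=> [D D0 hD] [E E0 hE]; exists (D + E) => [|n f]; first exact: addr_ge0.
rewrite op_addE !mulrDl; apply: le_trans (l2norm_triangle _ _) _.
by apply: lerD; [exact: hD|exact: hE].
Qed.

Lemma geometricMl S U : geometric U -> geometric (fun n => S * U n).
Proof.
move=> [D D0 hD]; have [M M0 hM] := op_bound S.
exists (M * D) => [|n f]; first exact: mulr_ge0.
apply: le_trans (hM _) _; rewrite -[M * D * _]mulrA -[leRHS]mulrA ler_wpM2l //.
exact: hD.
Qed.

Lemma geometricMr S U : geometric U -> geometric (fun n => U n * S).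
Proof.
move=> [D D0 hD]; have [M M0 hM] := op_bound S.
exists (D * M) => [|n f]; first exact: mulr_ge0.
apply: le_trans (hD _ _) _.
rewrite [D * M * _]mulrAC -[leRHS]mulrA ler_wpM2l ?hM //.
by rewrite mulr_ge0 // exprn_ge0 // ltW.
Qed.

Lemma geometric0 : geometric (fun=> 0).
Proof. by exists 0 => // n f; rewrite !mul0r [_ f]/(0 : ell2 R G) l2norm0. Qed.

Lemma geometric_sum (I : Type) (s : seq I) (U : I -> nat -> op) :
  (forall i, geometric (U i)) -> geometric (fun n => \sum_(i <- s) U i n).
Proof.
move=> hU; elim: s => [|i s IH].
  by under eq_fun do rewrite big_nil; exact: geometric0.
by under eq_fun do rewrite big_cons; exact: geometricD.
Qed.

Lemma geometricN U : geometric U -> geometric (fun n => - U n).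
Proof.
move=> [D D0 hD]; exists D => // n f.
by rewrite [(- U n) f]/(- (U n f)) l2normN hD.
Qed.

Lemma geometric_cst S : geometric (fun=> S) -> S = 0.
Proof.
move=> [D D0 hD]; apply: op_eqP => f; apply: l2norm_eq0.
apply: (@le_add_geometric R q q0 q1 _ 0 (D * l2norm f)) => n.
by rewrite add0r mulrAC; exact: hD.
Qed.

(** The limit exists vector by vector; it is linear because the limit of a
geometrically convergent sequence is unique. *)
Lemma op_geometric_cvg (U : nat -> op) :
  geometric (fun n => U n.+1 - U n) -> exists S, geometric (fun n => S - U n).
Proof.
move=> [D D0 hD]; pose E := 2 * (D / (1 - q)).
have E0 : 0 <= E by rewrite mulr_ge0 ?divr_ge0 // subr_ge0 ltW.
have /choice[S hS] f : exists F, forall n, l2norm (F - U n f) <= E * l2norm f * q ^+ n.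
  have [||F hF] := @ell2_geometric_cvg _ _ q (D * l2norm f) (fun n => U n f) q0 q1.
  - by rewrite mulr_ge0 ?l2norm_ge0.
  - by move=> n; rewrite mulrAC; exact: hD.
  exists F => n; apply: le_trans (hF n) _; rewrite le_eqVlt; apply/orP; left.
  by apply/eqP; rewrite /E; ring.
have bS n : bounded_by (E * q ^+ n) (fun f => S f - U n f).
  by move=> f; rewrite mulrAC; exact: hS.
have linS : linear S.
  move=> c u v; apply/eqP; rewrite -subr_eq0; apply/eqP; apply: l2norm_eq0.
  pose K := E * l2norm (c *: u + v) + (normc c * (E * l2norm u) + E * l2norm v).
  apply: (@le_add_geometric R q q0 q1 _ 0 K) => n.
  have -> : S (c *: u + v) - (c *: S u + S v) =
    (S (c *: u + v) - U n (c *: u + v)) - (c *: (S u - U n u) + (S v - U n v)).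
    rewrite op_linear scalerBr [X in _ = _ - X]addrACA -opprD.
    by rewrite opprB addrA subrK.
  rewrite add0r; apply: le_trans (l2norm_triangle _ _) _; rewrite l2normN.
  rewrite /K mulrDl; apply: lerD; first exact: hS.
  rewrite mulrDl; apply: le_trans (l2norm_triangle _ _) _; apply: lerD; last exact: hS.
  apply: le_trans (l2normZ_le _ _) _.
  by rewrite -mulrA ler_wpM2l ?normc_ge0.
have [M M0 hM] := op_bound (U 0%N).
have bl : bounded_linear S.
  apply/asboolP; split=> //; exists (E + M) => f.
  rewrite -(subrK (U 0%N f) (S f)) mulrDl; apply: le_trans (l2norm_triangle _ _) _.
  by apply: lerD; [have := bS 0%N f; rewrite expr0 mulr1|exact: hM].
by exists (BoundedOp bl), E.
Qed.

Lemma in_cstar_red_geometric S (U : nat -> A) :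
  geometric (fun n => S - U n) -> in_cstar_red S.
Proof.
move=> [D D0 hD]; apply/asboolP => e e0.
have [|n hn] := @unbounded_expr _ q^-1 (D / (e / 2)); first by rewrite invf_gt1.
have hne : D * q ^+ n <= e / 2.
  move: hn; rewrite exprVn ltr_pdivrMr ?divr_gt0 // mulrC.
  by rewrite ltr_pdivlMr ?exprn_gt0 // => /ltW.
have /asboolP/(_ (e / 2)) := cstar_redP (U n); rewrite divr_gt0 // => /(_ isT)[V sV bV].
exists V => // f; have -> : (S - V) f = (S - cstar_op (U n)) f + (cstar_op (U n) - V) f.
  by rewrite -op_addE addrA subrK.
apply: le_trans (l2norm_triangle _ _) _.
have h1 := bounded_byS hne (hD n) f; have h2 := bV f.
apply: le_trans (lerD h1 h2) _.
by rewrite -mulrDl -splitr.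
Qed.

(** The entries of the partial sums [P n] converge to those of some [S].  Each
entry of [(1 - Y) * S - 1] is constant in [n], but it is also an entry of
[(1 - Y) * (S - P n) - Y ^+ n], which decays geometrically; hence it is 0. *)
Lemma neumann_inverse k (Y : 'M[A]_k) :
  (forall i j, geometric (fun n => cstar_op ((Y ^+ n) i j))) ->
  exists S : 'M[A]_k, (1 - Y) * S = 1 /\ S * (1 - Y) = 1.
Proof.
move=> hY; pose P n := \sum_(m < n) Y ^+ m.
have PS n : P n.+1 = P n + Y ^+ n by rewrite /P big_ord_recr.
have valB (x y : A) : cstar_op (x - y) = cstar_op x - cstar_op y by [].
have ex i j : exists s : A, geometric (fun n => cstar_op (s - P n i j)).
  have [|s hs] := @op_geometric_cvg (fun n => cstar_op (P n i j)).
    have := hY i j; congr geometric; apply/funext => n.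
    by rewrite -valB PS [(P n + _) i j]mxE addrAC subrr add0r.
  by exists (CstarRed (in_cstar_red_geometric hs)).
have [s hs] := choice (fun p : 'I_k * 'I_k => ex p.1 p.2).
pose S : 'M[A]_k := \matrix_(i, j) s (i, j).
have hS i j : geometric (fun n => cstar_op ((S - P n) i j)).
  have := hs (i, j); congr geometric; apply/funext => n; congr cstar_op.
  by rewrite !mxE.
have val_sum (I : Type) (r : seq I) (F : I -> A) :
    cstar_op (\sum_(i <- r) F i) = \sum_(i <- r) cstar_op (F i).
  by elim: r => [|x r IH]; rewrite ?big_nil // !big_cons -IH.
have telL n : (1 - Y) * P n = 1 - Y ^+ n.
  elim: n => [|n IH]; first by rewrite /P big_ord0 mulr0 expr0 subrr.
  by rewrite PS mulrDr IH mulrBl mul1r exprS addrA subrK.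
have telR n : P n * (1 - Y) = 1 - Y ^+ n.
  elim: n => [|n IH]; first by rewrite /P big_ord0 mul0r expr0 subrr.
  by rewrite PS mulrDl IH mulrBr mulr1 exprSr addrA subrK.
exists S; split; apply/eqP; rewrite -subr_eq0; apply/eqP/matrixP => i j.
  have e n : (1 - Y) * S - 1 = (1 - Y) * (S - P n) - Y ^+ n.
    by rewrite mulrBr telL opprB -addrA; congr (_ + _); rewrite addrAC subrr sub0r.
  apply: val_inj; rewrite [in RHS]mxE /=; apply: geometric_cst.
  have : geometric (fun n => \sum_l cstar_op ((1 - Y) i l) * cstar_op ((S - P n) l j) + - cstar_op ((Y ^+ n) i j)).
    apply: geometricD; last exact: geometricN.
    by apply: geometric_sum => l; exact: geometricMl.
  congr geometric; apply/funext => n; rewrite (e n) !mxE valB val_sum; congr (_ - _).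
have e n : S * (1 - Y) - 1 = (S - P n) * (1 - Y) - Y ^+ n.
  by rewrite mulrBl telR opprB -addrA; congr (_ + _); rewrite addrAC subrr sub0r.
apply: val_inj; rewrite [in RHS]mxE /=; apply: geometric_cst.
have : geometric (fun n => \sum_l cstar_op ((S - P n) i l) * cstar_op ((1 - Y) l j) + - cstar_op ((Y ^+ n) i j)).
  apply: geometricD; last exact: geometricN.
  by apply: geometric_sum => l; exact: geometricMr.
congr geometric; apply/funext => n; rewrite (e n) !mxE valB val_sum; congr (_ - _).
Qed.

End Operators.

(** * The spectrum of the operator *)

Section TensorOperator.
Variables (R : realType) (g k : nat) (X : 'I_g -> 'M[R[i]]_k).
Local Notation C := R[i].
Local Notation G := (free_group g).
Local Notation A := (cstar_red R G).

Definition haar_sum : 'M[A]_k := \sum_(j < g) tens_elt (X j) (free_haar R j).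

Definition word_sum (s : seq (seq 'I_g)) (a : seq 'I_g -> C) : A :=
  \sum_(w <- s) a w *: cstar_lambda R (positive w).

Lemma cstar_lambdaM (x y : G) :
  cstar_lambda R (x * y)%g = cstar_lambda R x * cstar_lambda R y.
Proof. by apply: val_inj; rewrite /= lambdaM. Qed.

Lemma haar_sum_expr n i j :
  (haar_sum ^+ n) i j = word_sum (words g n) (coef X i j).
Proof.
elim: n i j => [|n IH] i j.
  rewrite expr0 /word_sum big_seq1 /coef /= mxE.
  have -> : cstar_lambda R (1 : G)%g = 1 by apply: val_inj; exact: lambda1.
  by rewrite !mxE; case: (i == j); rewrite ?scale1r ?scale0r.
rewrite exprS mxE /word_sum big_words.
transitivity (\sum_l \sum_j' \sum_(w <- words g n)
   (X j' i l * coef X l j w) *: cstar_lambda R (free_gen j' * positive w)%g).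
  apply: eq_bigr => l _; rewrite IH /haar_sum summxE mulr_suml.
  apply: eq_bigr => j' _; rewrite mxE mulr_sumr; apply: eq_bigr => w _.
  by rewrite cstar_lambdaM -scalerAl -scalerAr scalerA.
rewrite exchange_big; apply: eq_bigr => j' _.
rewrite exchange_big; apply: eq_bigr => w _.
by rewrite -scaler_suml; congr (_ *: _); rewrite /coef /= [RHS]mxE.
Qed.

Lemma cstar_op_sum (I : Type) (r : seq I) (F : I -> A) f y :
  cstar_op (\sum_(i <- r) F i) f y = \sum_(i <- r) cstar_op (F i) f y.
Proof. by elim: r => [|x r IH]; rewrite ?big_nil // !big_cons -IH. Qed.

Lemma cstar_op_sumE (I : Type) (r : seq I) (F : I -> A) f :
  cstar_op (\sum_(i <- r) F i) f = \sum_(i <- r) cstar_op (F i) f.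
Proof. by elim: r => [|x r IH]; rewrite ?big_nil // !big_cons -IH. Qed.

Lemma cstar_opB (x y : A) f : cstar_op (x - y) f = cstar_op x f - cstar_op y f.
Proof. by []. Qed.

Lemma word_sumE s a f y :
  cstar_op (word_sum s a) f y = \sum_(w <- s) a w * f ((positive w)^-1 * y)%g.
Proof. by rewrite cstar_op_sum. Qed.

Lemma word_sum_bound n a (f : ell2 R G) :
  (sqsum (cstar_op (word_sum (words g n) a) f) <=
   (n.+1%:R ^+ 2 * energy n a)%:E * sqsum f)%E.
Proof.
apply: le_trans (haagerup_convol n a f); rewrite le_eqVlt; apply/orP; left.
by apply/eqP; congr sqsum; apply/funext => y; rewrite word_sumE.
Qed.

(** Distinct words translate the basis vector at the unit to distinct basis
vectors. *)
Lemma word_sum_delta s a : uniq s ->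
  l2norm (cstar_op (word_sum s a) (delta R 1%g)) ^+ 2 =
  \sum_(w <- s) normc (a w) ^+ 2.
Proof.
move=> us; apply: EFin_inj; rewrite -sqsum_l2norm.
have -> : (cstar_op (word_sum s a) (delta R 1%g) : G -> C) =
    (fun y => \sum_(w <- s) a w * (y == positive w)%:R).
  apply/funext => y; rewrite word_sumE; apply: eq_bigr => w _.
  by rewrite /= /delta_fun -(inj_eq (mulgI (positive w))) mulVKg mulg1.
have ptw (y : G) : normc (\sum_(w <- s) a w * (y == positive w)%:R) ^+ 2 =
    \sum_(w <- s) (if y == positive w then normc (a w) ^+ 2 else 0).
  have [/mapP[w ws ->]|ynot] := boolP (y \in [seq positive w | w <- s]).
    rewrite (bigD1_seq w) //= eqxx mulr1 big1 ?addr0 => [|v vw].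
      rewrite [RHS](bigD1_seq w) //= eqxx big1 ?addr0 // => v vw.
      by rewrite (inj_eq (@positive_inj g)) eq_sym (negbTE vw).
    by rewrite (inj_eq (@positive_inj g)) eq_sym (negbTE vw) mulr0.
  have yne w : w \in s -> (y == positive w) = false.
    by move=> ws; apply: contraNF ynot => /eqP ->; exact: map_f.
  rewrite big_seq big1 => [|w ws]; last by rewrite yne // mulr0.
  by rewrite normc0 expr0n big_seq big1 // => w ws; rewrite yne.
rewrite /sqsum; under eq_esum do rewrite ptw -sumEFin.
rewrite esum_sum; last by move=> y w _ _; case: ifP; rewrite lee_fin ?sqr_ge0.
rewrite -sumEFin; apply: eq_bigr => w _.
rewrite (esumID [set positive w]); last first.
  by move=> y _; case: ifP; rewrite lee_fin ?sqr_ge0.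
rewrite setTI esum_set1 ?eqxx ?lee_fin ?sqr_ge0 //.
by rewrite esum1 ?adde0 // => y [_ /= /eqP/negbTE ->].
Qed.

Definition mx_scale (c : C) (M : 'M[A]_k) : 'M[A]_k := map_mx ( *:%R c) M.

Lemma mx_scaleMl c M N : mx_scale c M * N = mx_scale c (M * N).
Proof.
apply/matrixP => i j; rewrite !mxE scaler_sumr; apply: eq_bigr => l _.
by rewrite mxE scalerAl.
Qed.

Lemma mx_scaleMr c M N : M * mx_scale c N = mx_scale c (M * N).
Proof.
apply/matrixP => i j; rewrite !mxE scaler_sumr; apply: eq_bigr => l _.
by rewrite mxE scalerAr.
Qed.

Lemma mx_scaleA c d M : mx_scale c (mx_scale d M) = mx_scale (c * d) M.
Proof. by apply/matrixP => i j; rewrite !mxE scalerA. Qed.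

Lemma mx_scale1 M : mx_scale 1 M = M.
Proof. by apply/matrixP => i j; rewrite !mxE scale1r. Qed.

Lemma mx_scale_expr c M n : mx_scale c M ^+ n = mx_scale (c ^+ n) (M ^+ n).
Proof.
elim: n => [|n IH]; first by rewrite !expr0 mx_scale1.
by rewrite !exprS IH mx_scaleMl mx_scaleMr mx_scaleA.
Qed.

Lemma mx_scale_resolvent z M : z != 0 ->
  mx_scale z (1 - mx_scale z^-1 M) = (z%:A)%:M - M.
Proof.
move=> z0; apply/matrixP => i j; rewrite !mxE scalerBr scalerA mulfV // scale1r.
by congr (_ - _); case: (i == j); rewrite ?mulr1n // !mulr0n scaler0.
Qed.

Lemma word_sumZ c s a : c *: word_sum s a = word_sum s (fun w => c * a w).
Proof. by rewrite /word_sum scaler_sumr; apply: eq_bigr => w _; rewrite scalerA. Qed.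

(** The entries of [(T / z) ^+ n] have norm at most
[(n + 1) * sqrt (D * (r / |z| ^ 2) ^ n)] for an [r] strictly between the
spectral radius and [|z| ^ 2], and the factor [n + 1] is absorbed by replacing
[y = sqrt (r / |z| ^ 2)] with a slightly larger [q < 1]. *)
Lemma outside_spectrum z :
  mx_spectral_radius (kraus_mx X) < normc z ^+ 2 ->
  ~ spectrum (fun c => (c%:A)%:M) haar_sum z.
Proof.
set rho := mx_spectral_radius _ => hz.
have rho0 : 0 <= rho := mx_spectral_radius_ge0 _.
have nz2 : 0 < normc z ^+ 2 := le_lt_trans rho0 hz.
have nz : 0 < normc z.
  by rewrite lt_neqAle normc_ge0 andbT eq_sym -sqrf_eq0 gt_eqF.
have z0 : z != 0 by apply: contraTneq nz => ->; rewrite normc0 ltxx.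
pose r := (rho + normc z ^+ 2) / 2.
have rho_r : rho < r by rewrite /r; lra.
have r_z : r < normc z ^+ 2 by rewrite /r; lra.
have r0 : 0 < r := le_lt_trans rho0 rho_r.
have [D D0 hD] := energy_growth rho_r.
pose y := Num.sqrt (r / normc z ^+ 2).
have y0 : 0 < y by rewrite sqrtr_gt0 divr_gt0.
have y2 : y ^+ 2 = r / normc z ^+ 2 by rewrite sqr_sqrtr // divr_ge0 // ltW.
have y1 : y < 1.
  rewrite -ltr_sqr ?nnegrE ?(ltW y0) // y2 expr1n ltr_pdivrMr ?mul1r //.
pose q := (1 + y) / 2.
have q0 : 0 < q by rewrite /q; lra.
have q1 : q < 1 by rewrite /q; lra.
have yq : 1 < q / y by rewrite ltr_pdivlMr // mul1r /q; lra.
have [E E0 hE] := linear_lt_expr yq.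
pose Y := mx_scale z^-1 haar_sum.
have YE n i j : (Y ^+ n) i j = word_sum (words g n) (fun w => z^-1 ^+ n * coef X i j w).
  by rewrite mx_scale_expr mxE haar_sum_expr word_sumZ.
have hY i j : geometric q (fun n => cstar_op ((Y ^+ n) i j)).
  exists (E * (D + 1)) => [|n f]; first by rewrite mulr_ge0 ?addr_ge0.
  have B0 : 0 <= E * (D + 1) * q ^+ n * l2norm f.
    apply: mulr_ge0 (l2norm_ge0 _); apply: mulr_ge0; last exact: exprn_ge0 (ltW q0).
    by rewrite mulr_ge0 ?addr_ge0.
  apply: l2norm_le => //; rewrite YE.
  apply: le_trans (word_sum_bound _ _ _) _.
  rewrite sqsum_l2norm -EFinM lee_fin [leRHS]exprMn ler_wpM2r ?sqr_ge0 //.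
  have -> : energy n (fun w => z^-1 ^+ n * coef X i j w) =
      (normc z ^+ 2)^-1 ^+ n * energy n (coef X i j).
    rewrite /energy mulr_sumr; apply: eq_bigr => w _.
    by rewrite normcM exprMn normc_invX_sqr.
  have hD' : (normc z ^+ 2)^-1 ^+ n * energy n (coef X i j) <= D * (y ^+ 2) ^+ n.
    rewrite y2 [r / _]mulrC exprMn mulrCA ler_wpM2l ?hD //.
    by rewrite exprn_ge0 // invr_ge0 ltW.
  apply: (@le_trans _ _ ((E * (q / y) ^+ n) ^+ 2 * (D * (y ^+ 2) ^+ n))).
    apply: ler_pM => //.
      by rewrite mulr_ge0 ?energy_ge0 // exprn_ge0 // invr_ge0 ltW.
    by rewrite ler_sqr ?nnegrE ?ler0n // mulr_ge0 // exprn_ge0 // divr_ge0 // ltW.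
  have -> : (E * (q / y) ^+ n) ^+ 2 * (D * (y ^+ 2) ^+ n) = (E * q ^+ n) ^+ 2 * D.
    rewrite -exprM mulnC exprM expr_div_n.
    by field; rewrite expf_neq0 // gt_eqF.
  rewrite [E * (D + 1) * _]mulrAC [leRHS]exprMn ler_wpM2l ?sqr_ge0 //.
  by nra.
have [S [S1 S2]] := neumann_inverse q0 q1 hY.
apply; exists (mx_scale z^-1 S).
rewrite -mx_scale_resolvent // !mx_scaleMl !mx_scaleMr !mx_scaleA S1 S2.
by rewrite mulfV // mulVf // mx_scale1.
Qed.

(** A left inverse of [z - T] would bound the partial sums of the normalized
total energies [c] by [K (1 + c N)], against [exponential_gap]. *)
Lemma sqrt_radius_in_spectrum :
  0 < mx_spectral_radius (kraus_mx X) ->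
  spectrum (fun c => (c%:A)%:M) haar_sum
    (Num.sqrt (mx_spectral_radius (kraus_mx X)))%:C%C.
Proof.
set rho := mx_spectral_radius _ => rho0; set z := (Num.sqrt rho)%:C%C.
have nz2 : normc z ^+ 2 = rho.
  by rewrite normc_real ger0_norm ?sqrtr_ge0 // sqr_sqrtr // ltW.
have z0 : z != 0.
  by apply: contraTneq rho0 => z0; rewrite -nz2 z0 normc0 expr0n ltxx.
have k0 : (0 < k)%N.
  by have := mx_spectral_radius_gt0_size rho0; rewrite muln_gt0 => /andP[].
move=> [b [_ hb]].
pose Y := mx_scale z^-1 haar_sum; pose B := mx_scale z b.
have BY : B * (1 - Y) = 1.
  by rewrite mx_scaleMl -mx_scaleMr mx_scale_resolvent.
pose P N := \sum_(n < N) Y ^+ n.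
have PS n : P n.+1 = P n + Y ^+ n by rewrite /P big_ord_recr.
have tel n : (1 - Y) * P n = 1 - Y ^+ n.
  elim: n => [|n IH]; first by rewrite /P big_ord0 mulr0 expr0 subrr.
  by rewrite PS mulrDr IH mulrBl mul1r exprS addrA subrK.
have PB N : P N = B - B * Y ^+ N.
  by rewrite -[LHS]mul1r -BY -mulrA tel mulrBr mulr1.
pose a i j (w : seq 'I_g) := z^-1 ^+ size w * coef X i j w.
have YE n i j : (Y ^+ n) i j = word_sum (words g n) (a i j).
  rewrite mx_scale_expr mxE haar_sum_expr word_sumZ /word_sum big_seq [RHS]big_seq.
  by apply: eq_bigr => w; rewrite mem_words /a => /eqP ->.
have PE N i j : (P N) i j = word_sum (words_lt g N) (a i j).
  elim: N => [|N IH]; first by rewrite /P big_ord0 mxE /word_sum big_nil.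
  by rewrite PS mxE IH YE /word_sum big_cat.
have aE n i j : \sum_(w <- words g n) normc (a i j w) ^+ 2 =
    rho^-1 ^+ n * energy n (coef X i j).
  rewrite /energy mulr_sumr big_seq [RHS]big_seq; apply: eq_bigr => w.
  rewrite mem_words => /eqP wn.
  by rewrite /a wn normcM exprMn normc_invX_sqr nz2.
have aPE N i j : \sum_(w <- words_lt g N) normc (a i j w) ^+ 2 =
    \sum_(n < N) rho^-1 ^+ n * energy n (coef X i j).
  elim: N => [|N IH]; first by rewrite big_nil big_ord0.
  by rewrite big_cat /= IH aE big_ord_recr.
pose c n := rho^-1 ^+ n * total_energy X n.
have rn n : 0 <= rho^-1 ^+ n by rewrite exprn_ge0 // invr_ge0 ltW.
have [M hM] := choice (fun p : 'I_k * 'I_k =>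
  let: ex_intro2 M M0 h := op_bound (cstar_op (B p.1 p.2)) in
  ex_intro (fun M => 0 <= M /\ bounded_by M (cstar_op (B p.1 p.2))) M (conj M0 h)).
pose m := \sum_p M p.
have m0 : 0 <= m by apply: sumr_ge0 => p _; case: (hM p).
have Bm i j f : l2norm (cstar_op (B i j) f) <= m * l2norm f.
  have [_ /(_ f) /= h] := hM (i, j); apply: le_trans h _.
  rewrite ler_wpM2r ?l2norm_ge0 // /m (bigD1 (i, j)) //= lerDl.
  by apply: sumr_ge0 => p _; case: (hM p).
pose L := l2norm (delta R (1 : G)%g); have L0 : 0 <= L := l2norm_ge0 _.
pose Q := 2 * m ^+ 2 * (L ^+ 2 + k%:R ^+ 2).
have Q0 : 0 <= Q.
  apply: mulr_ge0; first by rewrite mulr_ge0 ?sqr_ge0.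
  by rewrite addr_ge0 ?sqr_ge0.
have K0 : 0 < k%:R * (k%:R * Q) + 1 by rewrite ltr_wpDl // mulr_ge0 ?ler0n // mulr_ge0 ?ler0n.
have [e e0 he] := total_energy_ge X k0.
have rn0 n : 0 < rho ^+ n by rewrite exprn_gt0.
apply: (exponential_gap K0 e0 (c := c)).
- by move=> n; rewrite /c exprVn mulrC ler_pdivlMr ?he.
- move=> t t1; have rt : rho < rho * t by rewrite ltr_pMr.
  have [D D0 hD] := energy_growth rt.
  exists (\sum_(i < k) \sum_(j < k) D) => [|n].
    by apply: sumr_ge0 => *; apply: sumr_ge0.
  rewrite /c /total_energy mulr_sumr mulr_suml; apply: ler_sum => i _.
  rewrite mulr_sumr mulr_suml; apply: ler_sum => j _.
  apply: le_trans (ler_wpM2l (rn n) (hD n i j)) _.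
  by rewrite exprMn exprVn mulrCA mulKf // gt_eqF.
move=> N; have cN0 : 0 <= c N.
  by rewrite mulr_ge0 //; apply: sumr_ge0 => *; apply: sumr_ge0 => *; exact: energy_ge0.
pose x := Num.sqrt (c N); have x0 : 0 <= x := sqrtr_ge0 _.
have x2 : x ^+ 2 = c N by rewrite sqr_sqrtr.
have YNle l j : l2norm (cstar_op ((Y ^+ N) l j) (delta R 1%g)) <= x.
  rewrite -ler_sqr ?nnegrE ?l2norm_ge0 // x2 YE word_sum_delta ?uniq_words //.
  by rewrite aE ler_wpM2l ?energy_le_total.
have entry i j : \sum_(n < N) rho^-1 ^+ n * energy n (coef X i j) <= Q * (1 + c N).
  rewrite -aPE -word_sum_delta ?uniq_words_lt // -PE PB.
  have h : l2norm (cstar_op ((B - B * Y ^+ N) i j) (delta R 1%g)) <= m * (L + k%:R * x).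
    have -> : cstar_op ((B - B * Y ^+ N) i j) (delta R 1%g) =
       cstar_op (B i j) (delta R 1%g) -
       \sum_l cstar_op (B i l) (cstar_op ((Y ^+ N) l j) (delta R 1%g)).
      have -> : (B - B * Y ^+ N) i j = B i j - \sum_l B i l * (Y ^+ N) l j.
        by rewrite [LHS]mxE; congr (_ + _); rewrite [LHS]mxE; congr (- _); rewrite mxE.
      by rewrite cstar_opB cstar_op_sumE.
    apply: le_trans (l2norm_triangle _ _) _; rewrite l2normN mulrDr.
    apply: lerD; first exact: Bm.
    apply: le_trans (l2norm_sum _ _) _.
    rewrite mulrCA mulr_natl -[X in _ *+ X]card_ord -sumr_const.
    by apply: ler_sum => l _; apply: le_trans (Bm _ _ _) _; rewrite ler_wpM2l.
  apply: (@le_trans _ _ ((m * (L + k%:R * x)) ^+ 2)).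
    by rewrite ler_sqr ?nnegrE ?l2norm_ge0 // (le_trans (l2norm_ge0 _) h).
  (* With [kk = k%:R], [(L + kk * x) ^+ 2 <= 2 * (L ^+ 2 + kk ^+ 2 * x ^+ 2)],
     which is at most [2 * (L ^+ 2 + kk ^+ 2) * (1 + x ^+ 2)]. *)
  rewrite /Q -x2 exprMn [2 * _]mulrC -!mulrA ler_wpM2l ?sqr_ge0 //.
  have := sqr_ge0 (L - k%:R * x); have := sqr_ge0 (L * x); have := sqr_ge0 (k%:R : R).
  move: (k%:R : R) => kk; nra.
apply: (@le_trans _ _ (k%:R * (k%:R * Q) * (1 + c N))); last first.
  by rewrite ler_wpM2r ?addr_ge0 // lerDl.
have -> : \sum_(n < N) c n =
    \sum_i \sum_j \sum_(n < N) rho^-1 ^+ n * energy n (coef X i j).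
  under eq_bigr do rewrite /c /total_energy mulr_sumr.
  rewrite exchange_big; apply: eq_bigr => i _.
  under eq_bigr do rewrite mulr_sumr.
  by rewrite exchange_big.
rewrite -2!mulrA mulr_natl -[X in _ *+ X]card_ord -sumr_const.
apply: ler_sum => i _; rewrite mulr_natl -[X in _ *+ X]card_ord -sumr_const.
by apply: ler_sum => j _; exact: entry.
Qed.

End TensorOperator.

Theorem proposition1p7 (R : realType) (g k : nat) (X : 'I_g -> 'M[R[i]]_k) :
  tens_spectral_radius (\sum_(j < g) tens_elt (X j) (free_haar R j)) =
  Num.sqrt (mx_spectral_radius (\sum_(j < g) X j *t map_mx conjc (X j))).
Proof.
rewrite -/(haar_sum X) -/(kraus_mx X); set rho := mx_spectral_radius _.
have rho0 : 0 <= rho := mx_spectral_radius_ge0 _.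
rewrite /tens_spectral_radius /spectral_radius; set Sp := spectrum _ _.
have ub : ubound [set normc z | z in Sp] (Num.sqrt rho).
  move=> x [z zSp <-]; rewrite leNgt; apply/negP => hz.
  apply: (outside_spectrum (X := X) (z := z)) => //.
  rewrite -/rho -[rho]sqr_sqrtr // ltr_sqr ?nnegrE ?sqrtr_ge0 ?normc_ge0 //.
apply/eqP; rewrite eq_le; apply/andP; split.
  have [->|/set0P Sp0] := eqVneq [set normc z | z in Sp] set0.
    by rewrite sup0 sqrtr_ge0.
  exact: ge_sup.
have [rho_gt0|] := ltP 0 rho.
  apply: ub_le_sup; first by exists (Num.sqrt rho).
  exists (Num.sqrt rho)%:C%C; first exact: sqrt_radius_in_spectrum.
  by rewrite normc_real ger0_norm // sqrtr_ge0.
move=> /ler0_sqrtr ->.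
have [->|/set0P[_ [z zSp _]]] := eqVneq [set normc z | z in Sp] set0.
  by rewrite sup0.
apply: le_trans (normc_ge0 z) _.
by apply: ub_le_sup; [exists (Num.sqrt rho)|exists z].
Qed.
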